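(* Let $\alpha > -1$ and let $\sigma > 0$. The following estimates hold uniformly in $x,y >0$. (i) If $x+y \le 1$, then $$H^{\alpha,\sigma}(x,y) \simeq \chi_{\{\sigma > \alpha+1\}} + \chi_{\{\sigma=\alpha+1\}} \log\frac{1}{x+y} + (x+y)^{-2\alpha-1} \begin{cases} |x-y|^{2\sigma-1}, & \sigma < 1/2,\\ \log\frac{2(x+y)}{|x-y|}, & \sigma=1/2,\\ (x+y)^{2\sigma-1}, & \sigma > 1/2. \end{cases}$$ (ii) If $x+y > 1$, then $$H^{\alpha,\sigma}(x,y) \simeq \simeq (x+y)^{-2\alpha-1} \exp\big(-c|x-y|\big) \begin{cases} |x-y|^{2\sigma-1}, & \sigma < 1/2,\\ 1+\log^+ \frac{1}{|x-y|}, & \sigma=1/2,\\ 1, & \sigma> 1/2. \end{cases}$$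
   Context: For $\alpha>-1$ let $I_\alpha$ denote the modified Bessel function of the first kind of order $\alpha$, and for $t,x,y>0$ let $$W_t^{\alpha}(x,y)=\frac{1}{2t}\exp\Big(-\frac{x^2+y^2}{4t}\Big)(xy)^{-\alpha}I_\alpha\Big(\frac{xy}{2t}\Big).$$ For $\sigma>0$ and $x,y>0$ define the Bessel potential kernel $$H^{\alpha,\sigma}(x,y)=\frac1{\Gamma(\sigma)}\int_0^\infty e^{-t}W_t^\alpha(x,y)\,t^{\sigma-1}\,dt.$$ $\chi_{\{\cdot\}}$ equals $1$ if the condition holds and $0$ otherwise; $\log^+=\max(\log,0)$. $X\simeq Y$ means $C^{-1}Y\le X\le CY$ with $C>0$ independent of $x,y$. $X\simeq\simeq Y\exp(-cZ)$ means that there are constants $C,c_1,c_2>0$ independent of $x,y$ such that $C^{-1}Y\exp(-c_1Z)\le X\le C\,Y\exp(-c_2Z)$. Positive expressions are valued in $[0,\infty]$ with natural limiting interpretations (e.g. $0^\beta=\infty$ for $\beta<0$, $\log(c/0)=\infty$ for $c>0$). *)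

(* Defs.v *)
From HB Require Import structures.
From mathcomp Require Import all_boot all_order all_algebra.
From mathcomp Require Import all_classical all_reals all_analysis.
Set Implicit Arguments.
Unset Strict Implicit.
Unset Printing Implicit Defensive.
Import Order.TTheory GRing.Theory Num.Theory.
Import numFieldNormedType.Exports.
Local Open Scope classical_set_scope.
Local Open Scope ring_scope.

(* Euler's integral; meaningful for s > 0, the only range in which it is used. *)
Definition Gamma (R : realType) (s : R) : R :=
  \int[@lebesgue_measure R]_(t in `]0, +oo[) (expR (- t) * t `^ (s - 1)).

(* I_alpha(z) = sum_k (z/2)^(2k+alpha) / (k! Gamma(k+alpha+1)), for alpha > -1
   and z > 0. *)
Definition besselI (R : realType) (alpha z : R) : R :=
  limn [series (z / 2) `^ (2 * k%:R + alpha)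
                 / (k`!%:R * Gamma (k%:R + alpha + 1))]_k.

Definition besselW (R : realType) (alpha t x y : R) : R :=
  (2 * t)^-1 * expR (- ((x ^+ 2 + y ^+ 2) / (4 * t)))
  * (x * y) `^ (- alpha) * besselI alpha (x * y / (2 * t)).

(* The integral may diverge (on the diagonal), hence the values in \bar R. *)
Definition besselH (R : realType) (alpha sigma x y : R) : \bar R :=
  (((Gamma sigma)^-1)%:E *
   \int[@lebesgue_measure R]_(t in `]0%R, +oo[)
     (expR (- t) * besselW alpha t x y * t `^ (sigma - 1))%:E)%E.

(* Real power of r >= 0 with 0 ^ beta = +oo for beta < 0; the library's powR has
   0 `^ beta = 0 there. *)
Definition powRy (R : realType) (r beta : R) : \bar R :=
  if (r == 0) && (beta < 0) then +oo%E else (r `^ beta)%:E.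

(* log (c / d) for c > 0 and d >= 0, with value +oo when d = 0: in \bar R one has
   c / 0 = +oo and lne +oo = +oo. *)
Definition log_quot (R : realType) (c d : R) : \bar R :=
  lne (c%:E / d%:E)%E.

Definition log_plus_quot (R : realType) (c d : R) : \bar R :=
  maxe (log_quot c d) 0%E.

(* X ~ Y uniformly over the x, y > 0 satisfying D. *)
Definition simeq_on (R : realType) (D : R -> R -> Prop)
    (X Y : R -> R -> \bar R) : Prop :=
  exists C : R, 0 < C /\
    forall x y : R, 0 < x -> 0 < y -> D x y ->
      ((C^-1)%:E * Y x y <= X x y)%E /\ (X x y <= C%:E * Y x y)%E.

(* X ~~ Y exp(-cZ) uniformly over the x, y > 0 satisfying D: the constant in the
   exponent may differ between the lower and the upper bound. *)
Definition simeq_exp_on (R : realType) (D : R -> R -> Prop)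
    (X Y : R -> R -> \bar R) (Z : R -> R -> R) : Prop :=
  exists C c1 c2 : R, [/\ 0 < C, 0 < c1, 0 < c2 &
    forall x y : R, 0 < x -> 0 < y -> D x y ->
      ((C^-1)%:E * Y x y * (expR (- (c1 * Z x y)))%:E <= X x y)%E /\
      (X x y <= C%:E * Y x y * (expR (- (c2 * Z x y)))%:E)%E].

(* Main.v *)
Require Import Defs.
From HB Require Import structures.
From mathcomp Require Import all_boot all_order all_algebra.
From mathcomp Require Import all_classical all_reals all_analysis.
From mathcomp Require Import measurable_realfun.
From mathcomp Require Import ring lra.
Import Order.TTheory GRing.Theory Num.Theory.
Import numFieldNormedType.Exports.
Local Open Scope classical_set_scope.
Local Open Scope ring_scope.

(** Write b = alpha + 1/2, s = x + y and d = |x - y|. The potential integrates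
    the heat kernel W_t over the times t, and its size is found from a sharp
    envelope of that kernel.

    The power series of I_alpha is compared term by term with the one of the
    hyperbolic cosine. By the functional equation of Gamma, the number
    k! Gamma (k + alpha + 1) is (2k)! 4^(-k) (k + 1)^b up to constants
    ([bessel_weight_asymptotics]), so that I_alpha (z) / z^alpha is comparable
    to the sum over k of (k + 1)^(-b) z^(2k) / (2k)!. The weights
    z^(2k) / (2k)! have total mass of order e^z and concentrate where k + 1 is
    of order 1 + z, strongly enough for all positive and negative moments
    ([poisson_moment_le], [poisson_moment_ge]). Hence I_alpha (z) is comparable
    to z^alpha (1 + z)^(-b) e^z for all z > 0 ([besselI_bounds]). As
    4xy = s^2 - d^2, this puts W_t between two multiples of
      t^(-1/2) (t + s^2)^(-b) exp (- c d^2 / t)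
    with a smaller c in the upper bound than in the lower one
    ([besselW_bounds]).

    It remains to estimate, for fixed c > 0, the integral over t > 0 of
      e^(-t) t^(sigma - 3/2) (t + s^2)^(-b) exp (- c d^2 / t),
    called [envelope_potential]. When s <= 1 the times below d^2 are suppressed
    by the last factor. Between d^2 and s^2 the integrand is of
    order s^(-2b) t^(sigma - 3/2), which yields the factor singular in d.
    Between s^2 and 1 it is of order t^(sigma - alpha - 2), which yields the
    constant for sigma > alpha + 1 and the logarithm of 1 / (x + y) for
    sigma = alpha + 1. When s > 1 the same singularity in d comes from t <= 1,
    and the exponential decay from t + c d^2 / t >= 2 sqrt(c) d, which is nearly
    attained for t of order d. On the diagonal with sigma <= 1/2 both sides are
    infinite ([envelope_potential_diag]). *)

(** * Real powers *)
Section Powers.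
Context {R : realType}.
Implicit Types x y t p q : R.

Lemma powRD_gt0 t p q : 0 < t -> t `^ (p + q) = t `^ p * t `^ q.
Proof. by move=> t0; rewrite powRD// (gt_eqF t0) implybT. Qed.

Lemma powR_le_base p x y : 0 <= p -> 0 <= x -> x <= y -> x `^ p <= y `^ p.
Proof. by move=> p0 x0 xy; apply: ge0_ler_powR; rewrite ?nnegrE//; lra. Qed.

Lemma powR_ge_base p x y : p <= 0 -> 0 < x -> x <= y -> y `^ p <= x `^ p.
Proof.
move=> p0 x0 xy; rewrite -[p]opprK !(powRN _ (- p)).
by rewrite lef_pV2 ?posrE ?powR_gt0//; [apply: powR_le_base; lra|lra].
Qed.

(** The absolute value lets one constant serve exponents of both signs. *)
Lemma powR_comparable K p x y : 0 < x -> 0 < y -> x <= K * y -> y <= K * x ->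
  x `^ p <= K `^ `|p| * y `^ p.
Proof.
move=> x0 y0 xy yx.
have K0 : 0 < K by rewrite -(pmulr_lgt0 _ y0); lra.
have [p0|p0] := leP 0 p.
  rewrite ger0_norm// -powRM; [|lra|lra].
  by apply: powR_le_base => //; lra.
rewrite ltr0_norm// powRN ler_pdivlMl ?powR_gt0// -powRM; [|lra|lra].
by apply: powR_ge_base => //; lra.
Qed.

(** This is [ln v < v] at [v = e * u / (B + 1)]; the shift by 1 covers [B =
    0]. *)
Lemma powR_le_expR (B e : R) : 0 <= B -> 0 < e ->
  exists C, 0 < C /\ forall u, 0 < u -> u `^ B <= C * expR (e * u).
Proof.
move=> B0 e0; exists (((B + 1) / e) `^ B); split.
  by rewrite powR_gt0// divr_gt0//; lra.
move=> u u0; set v := e * u / (B + 1).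
have v0 : 0 < v by rewrite divr_gt0// ?mulr_gt0//; lra.
have -> : u = (B + 1) / e * v by rewrite /v; field; lra.
rewrite powRM; last 2 [by rewrite divr_ge0//; lra] => //; last exact: ltW.
rewrite ler_wpM2l ?powR_ge0//.
rewrite /powR (gt_eqF v0) ler_expR.
have -> : e * ((B + 1) / e * v) = B * v + v by field; lra.
have := ln_sublinear v0.
move=> lv; have h : B * ln v <= B * v by exact: ler_wpM2l (ltW lv).
by apply: (le_trans h); rewrite lerDl ltW.
Qed.
End Powers.

(** * Integrals of nonnegative functions *)
Section Integrals.
Context {R : realType}.
Notation mu := (@lebesgue_measure R).
Local Open Scope ereal_scope.
Implicit Types (D E : set R) (f g : R -> R).

(** Read off from the definition of the integral as a supremum over the simple
    functions below, so that it applies to the integrand of [besselH] without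
    a detour through the measurability of a sum of a series. *)
Lemma ge0_le_integral_subset D E (f g : R -> R) :
  D `<=` E -> (forall x, E x -> 0 <= g x)%R ->
  (forall x, D x -> 0 <= f x)%R -> (forall x, D x -> f x <= g x)%R ->
  \int[mu]_(x in D) (f x)%:E <= \int[mu]_(x in E) (g x)%:E.
Proof.
move=> DE g0 f0 fg; rewrite !ge0_integralE//.
apply: ge_ereal_sup => _ [h /= hf <-].
apply: ereal_sup_ubound => /=; exists h => // x.
apply: (le_trans (hf x)); rewrite /patch.
have [Dx|Dx] := pselect (D x).
  by rewrite !mem_set ?lee_fin; [apply: fg|apply: DE|].
rewrite (memNset Dx); have [Ex|Ex] := pselect (E x).
  by rewrite mem_set// lee_fin g0.
by rewrite memNset.
Qed.

Lemma ge0_integral_ge_cst D f (a b k : R) :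
  (a <= b)%R -> (0 <= k)%R ->
  `]a, b[ `<=` D -> (forall x, D x -> 0 <= f x)%R ->
  (forall x, a < x < b -> k <= f x)%R ->
  (k * (b - a))%:E <= \int[mu]_(x in D) (f x)%:E.
Proof.
move=> ab k0 sD f0 fk.
have -> : (k * (b - a))%:E = \int[mu]_(x in `]a, b[) (k%:E).
  rewrite integral_cst//= lebesgue_measure_itv/= lte_fin.
  case: ltP => [_|ba]; first by rewrite -EFinB -EFinM.
  by rewrite mule0 (_ : b = a) ?subrr ?mulr0//; apply/eqP; rewrite eq_le ba ab.
apply: (@ge0_le_integral_subset _ _ (fun=> k)) => // x /=; rewrite in_itv/=.
Qed.

Lemma ge0_integral_le_scale D f g (k K : R) :
  (0 <= k)%R -> measurable D -> measurable_fun setT g -> (forall t,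
    0 <= g t)%R ->
  (forall t, D t -> 0 <= f t)%R -> (forall t, D t -> f t <= k * g t)%R ->
  (\int[mu]_(t in D) (g t)%:E <= K%:E)%E ->
  (\int[mu]_(t in D) (f t)%:E <= (k * K)%:E)%E.
Proof.
move=> k0 mD mg g0 f0 fg gK.
apply: (@le_trans _ _ (\int[mu]_(t in D) (k * g t)%:E)%E).
  by apply: ge0_le_integral_subset => // t Dt; rewrite mulr_ge0.
under eq_integral do rewrite EFinM.
rewrite ge0_integralZl_EFin//=; last 2 first.
- by move=> t _; rewrite lee_fin.
- by apply/measurable_EFinP; exact: measurable_funTS.
by rewrite EFinM lee_wpmul2l// lee_fin.
Qed.

Lemma ge0_integral_split f (a : R) (x y : itv_bound R) :
  (x <= BRight a)%O -> (BRight a <= y)%O ->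
  measurable_fun setT f -> (forall t, 0 <= f t)%R ->
  \int[mu]_(t in [set` Interval x y]) (f t)%:E =
  \int[mu]_(t in [set` Interval x (BRight a)]) (f t)%:E +
  \int[mu]_(t in [set` Interval (BRight a) y]) (f t)%:E.
Proof.
move=> xa ay mf f0; rewrite (itv_bndbnd_setU xa ay) ge0_integral_setU//.
- by apply/measurable_EFinP; exact: measurable_funTS.
- by move=> t _; rewrite lee_fin.
- apply/disj_set2P; apply/seteqP; split => t //= -[].
  rewrite !itv_boundlr => /andP[_ /= ta] /andP[at_ _].
  by move: ta at_; rewrite !bnd_simp ltNge => ->.
Qed.

(** Monotone convergence along the segments from 1/n to n: an improper
    integral is bounded as soon as its truncations are, so that the
    fundamental theorem of calculus is only used on segments. *)
Lemma ge0_integral_le_compact D f (K : \bar R) :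
  measurable D -> D `<=` `]0%R, +oo[ ->
  measurable_fun setT f -> (forall x, 0 < x -> 0 <= f x)%R ->
  (forall u v, 0 < u -> u < v ->
    (\int[mu]_(x in D `&` `[u, v]) (f x)%:E <= K)%E)%R ->
  \int[mu]_(x in D) (f x)%:E <= K.
Proof.
move=> mD D0 mf f0 fK.
have mf' (E : set R) : measurable E -> measurable_fun E (EFin \o f).
  by move=> mE; apply/measurable_EFinP; exact: measurable_funS mf.
pose F (n : nat) : set R := D `&` `[(n.+2%:R)^-1%R, n.+2%:R].
have DE : D = \bigcup_i F i.
  apply/seteqP; split => [x Dx|x [n _ []]//].
  have := D0 _ Dx; rewrite /= in_itv/= andbT => x0.
  pose n := Num.trunc (x + x^-1)%R.
  have xn : (x + x^-1 < n.+1%:R)%R by rewrite truncnS_gt.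
  exists n => //; split => //=; rewrite in_itv/=.
  have xV : (0 < x^-1)%R by rewrite invr_gt0.
  have nn : (n.+1%:R <= n.+2%:R :> R)%R by rewrite ler_nat.
  apply/andP; split; last by lra.
  by rewrite invf_ple ?posrE ?ltr0n//; lra.
have mF i : measurable (F i) by apply: measurableI.
have nd : nondecreasing_seq F.
  apply/nondecreasing_seqP => n; apply/subsetPset => x [Dx /=].
  rewrite in_itv/= => /andP[nx xn]; split => //=; rewrite in_itv/=.
  have nn : (n.+2%:R <= n.+3%:R :> R)%R by rewrite ler_nat.
  by apply/andP; split; [apply: le_trans nx; rewrite lef_pV2 ?posrE ?ltr0n|lra].
have fF i x : F i x -> 0 <= (f x)%:E.
  by move=> [/D0/=]; rewrite in_itv/= andbT lee_fin => /f0.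
have cF : \int[mu]_(x in F i) (f x)%:E @[i --> \oo] -->
    \int[mu]_(x in \bigcup_i F i) (f x)%:E.
  exact: (@ge0_nondecreasing_set_cvg_integral _ (measurableTypeR R) R F
    (EFin \o f) _ nd mF (fun i => mf' _ (mF i)) fF).
rewrite DE -(cvg_lim _ cF)//.
apply: lime_le; first by apply/cvg_ex; eexists; exact: cF.
apply: nearW => n; apply: fK; first by rewrite invr_gt0 ltr0n.
have n1 : (1 < n.+2%:R :> R)%R by rewrite ltr1n.
by apply: (lt_trans _ n1); rewrite invf_lt1 ?ltr0n.
Qed.

Lemma gt0_derivable_LRcontinuous (F f : R -> R) (a b : R) : (0 < a)%R ->
  (a < b)%R ->
  (forall x : R, (0 < x)%R -> is_derive x 1%R F (f x)) ->
  derivable_oo_LRcontinuous F a b /\ {in `]a, b[, F^`()%classic =1 f}.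
Proof.
move=> a0 ab dF.
have cF x : (0 < x)%R -> {for x, continuous F}.
  by move=> x0; apply/differentiable_continuous/derivable1_diffP;
    case: (dF _ x0).
split; last first.
  move=> x; rewrite in_itv/= => /andP[ax _].
  by rewrite derive1E; have [_ ->] := dF x (lt_trans a0 ax).
split.
- move=> x; rewrite in_itv/= => /andP[ax _].
  by case: (dF x (lt_trans a0 ax)).
- by apply: cvg_at_right_filter; exact: cF.
- by apply: cvg_at_left_filter; apply: cF; exact: lt_trans ab.
Qed.

Lemma continuous_gt0_within (f : R -> R) (a b : R) : (0 < a)%R ->
  (forall x : R, (0 < x)%R -> {for x, continuous f}) ->
  {within `[a, b], continuous f}.
Proof.
move=> a0 cf; apply: continuous_in_subspaceT => x.
rewrite inE/= in_itv/= => /andP[ax _].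
by apply: cf; exact: lt_le_trans ax.
Qed.

Lemma integral_FTC (F f : R -> R) (a b : R) : (0 < a)%R -> (a < b)%R ->
  (forall x : R, (0 < x)%R -> is_derive x 1%R F (f x)) ->
  (forall x : R, (0 < x)%R -> {for x, continuous f}) ->
  \int[mu]_(x in `[a, b]) (f x)%:E = (F b - F a)%:E.
Proof.
move=> a0 ab dF cf; have [LR Ff] := gt0_derivable_LRcontinuous _ _ _ _ a0 ab dF.
by rewrite (@continuous_FTC2 _ f F)//; exact: continuous_gt0_within.
Qed.

Lemma continuous_powR (p x : R) : (0 < x)%R -> {for x,
  continuous (@powR R ^~ p)}.
Proof.
move=> x0; apply/differentiable_continuous/derivable1_diffP.
by apply: derivable_powR; rewrite in_itv/= x0.
Qed.

Lemma integral_powR_cc (p a b : R) : (p + 1 != 0)%R -> (0 < a)%R -> (a < b)%R ->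
  \int[mu]_(x in `[a, b]) (x `^ p)%:E =
  ((b `^ (p + 1) - a `^ (p + 1)) / (p + 1))%:E.
Proof.
move=> p1 a0 ab.
have dF (x : R) : (0 < x)%R ->
    is_derive x 1%R (fun x : R => x `^ (p + 1) / (p + 1))%R (x `^ p)%R.
  move=> x0; have d := is_derive1_powR (p + 1) x0.
  have -> : (fun x => x `^ (p + 1) / (p + 1))%R =
            ((p + 1)^-1 \*: (@powR R ^~ (p + 1)))%R.
    by apply/funext => y; rewrite /= mulrC.
  apply: (is_derive_eq (is_deriveZ _ d)).
  by rewrite addrK /GRing.scale/=; field.
rewrite (integral_FTC _ _ _ _ a0 ab dF); first by rewrite mulrBl.
by move=> x x0; exact: continuous_powR.
Qed.

Lemma integral_inv_cc (a b : R) : (0 < a)%R -> (a < b)%R ->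
  \int[mu]_(x in `[a, b]) (x `^ (-1))%:E = (ln (b / a))%:E.
Proof.
move=> a0 ab; have b0 := lt_trans a0 ab.
have dF (x : R) : (0 < x)%R -> is_derive x 1%R (@ln R) (x `^ (-1))%R.
  by move=> x0; rewrite powR_inv1 ?ltW//; exact: is_derive1_ln.
rewrite (integral_FTC _ _ _ _ a0 ab dF); first by rewrite ln_div ?posrE.
by move=> x x0; exact: continuous_powR.
Qed.

Lemma integral_powR_0 (p a : R) : (-1 < p)%R -> (0 < a)%R ->
  \int[mu]_(x in `]0%R, a]) (x `^ p)%:E <= (a `^ (p + 1) / (p + 1))%:E.
Proof.
move=> p1 a0; apply: ge0_integral_le_compact => //.
- by move=> x /=; rewrite !in_itv/= => /andP[->].
- by move=> x _; exact: powR_ge0.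
move=> u v u0 uv; pose c := Num.min u (a / 2)%R.
have c0 : (0 < c)%R by rewrite lt_min u0 divr_gt0.
have ca : (c < a)%R by rewrite gt_min; apply/orP; right; lra.
have cu : (c <= u)%R by rewrite ge_min lexx.
apply: (@le_trans _ _ (\int[mu]_(x in `[c, a]) (x `^ p)%:E)).
  apply: ge0_le_integral_subset => // [x [] /=|x _|x _]; rewrite ?powR_ge0//.
  by rewrite !in_itv/=; move=> ? ?; lra.
rewrite integral_powR_cc//; last lra.
by rewrite lee_fin ler_wpM2r ?invr_ge0 ?lerBlDl ?lerDr ?powR_ge0//; lra.
Qed.

Lemma integral_powR_y (p a : R) : (p < -1)%R -> (0 < a)%R ->
  \int[mu]_(x in `]a, +oo[) (x `^ p)%:E <= (a `^ (p + 1) / (- p - 1))%:E.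
Proof.
move=> p1 a0; apply: ge0_integral_le_compact => //.
- by move=> x /=; rewrite !in_itv/= !andbT; exact: lt_trans.
- by move=> x _; exact: powR_ge0.
move=> u v u0 uv; pose c := Num.max v (a + 1)%R.
have ca : (a < c)%R by rewrite lt_max; apply/orP; right; lra.
have cv : (v <= c)%R by rewrite le_max lexx.
apply: (@le_trans _ _ (\int[mu]_(x in `[a, c]) (x `^ p)%:E)).
  apply: ge0_le_integral_subset => // [x [] /=|x _|x _]; rewrite ?powR_ge0//.
  by rewrite !in_itv/=; move=> ? ?; lra.
rewrite integral_powR_cc//; last lra.
rewrite lee_fin (_ : (- p - 1) = - (p + 1))%R; last by ring.
rewrite invrN mulrN -mulNr ler_nM2r ?invr_lt0; last lra.
by rewrite lerBrDl subrr powR_ge0.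
Qed.

Lemma integral_inv_oc (a b : R) : (0 < a)%R -> (a <= b)%R ->
  \int[mu]_(x in `]a, b]) (x `^ (-1))%:E = (ln (b / a))%:E.
Proof.
move=> a0; rewrite le_eqVlt => /predU1P[<-|ab].
  by rewrite set_itvoc0 integral_set0 divff ?gt_eqF// ln1.
rewrite integral_itv_obnd_cbnd ?integral_inv_cc//.
by apply/measurable_EFinP; apply: measurable_funTS; exact: measurable_powR.
Qed.

Lemma ge0_integral_ge_inv D f (a b k : R) : (0 < a)%R -> (a <= b)%R ->
  (0 <= k)%R -> `]a, b] `<=` D -> (forall x, D x -> 0 <= f x)%R ->
  (forall x, a < x <= b -> k * x `^ (-1) <= f x)%R ->
  (k * ln (b / a))%:E <= \int[mu]_(x in D) (f x)%:E.
Proof.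
move=> a0 ab k0 sD f0 kf.
have -> : (k * ln (b / a))%:E = \int[mu]_(x in `]a, b]) (k * x `^ (-1))%:E.
  under eq_integral do rewrite EFinM.
  rewrite ge0_integralZl_EFin//= ?integral_inv_oc//.
  - by move=> x _; rewrite lee_fin powR_ge0.
  - by apply/measurable_EFinP; apply: measurable_funTS; exact: measurable_powR.
apply: ge0_le_integral_subset => // x; first by rewrite mulr_ge0 ?powR_ge0.
Qed.
End Integrals.

(** * The functional equation of the Gamma function *)
Section GammaFacts.
Context {R : realType}.
Notation mu := (@lebesgue_measure R).
Implicit Types s p t : R.

(** The exponential absorbs [t `^ (p + 2)] and leaves [t `^ (- 2)]. *)
Lemma integral_expR_powR_y (lam p : R) : 0 < lam ->
  exists K, 0 < K /\
  (\int[mu]_(t in `]1%R, +oo[) (expR (- (lam * t)) * t `^ p)%:E <= K%:E)%E.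
Proof.
move=> l0.
have [C [C0 HC]] := powR_le_expR `|p + 2| lam (normr_ge0 _) l0.
exists C; split => //.
rewrite -[C]mulr1; apply: (@ge0_integral_le_scale _ _ _ (@powR R ^~ (- 2))).
- exact: ltW.
- by [].
- exact: measurable_powR.
- by move=> t; exact: powR_ge0.
- by move=> t _; rewrite mulr_ge0 ?expR_ge0 ?powR_ge0.
- move=> t /=; rewrite in_itv/= andbT => t1; have t0 : 0 < t by lra.
  have -> : p = (p + 2) + - 2 by ring.
  rewrite powRD_gt0// mulrA ler_wpM2r ?powR_ge0// expRN ler_pdivrMl ?expR_gt0//.
  rewrite mulrC; apply: le_trans (HC _ t0).
  by apply: ler_powR; [lra|exact: ler_norm].
apply: (le_trans (integral_powR_y _ _ _ _)); [lra|lra|].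
rewrite lee_fin powR1/= (_ : - - 2 - 1 = 1 :> R); last by ring.
by rewrite divr1.
Qed.

Lemma measurable_gamma_integrand s :
  measurable_fun setT (fun t : R => expR (- t) * t `^ s).
Proof.
apply: measurable_funM; last exact: measurable_powR.
by apply: measurableT_comp => //; exact: measurable_funN.
Qed.

Definition gamma_integral s := (\int[mu]_(t in `]0%R,
  +oo[) (expR (- t) * t `^ (s - 1))%:E)%E.

Lemma gamma_integral_ge0 s : (0 <= gamma_integral s)%E.
Proof.
by apply: integral_ge0 => t _; rewrite lee_fin mulr_ge0 ?expR_ge0 ?powR_ge0.
Qed.

Lemma gamma_integral_lty s : 0 < s -> (gamma_integral s < +oo)%E.
Proof.
move=> s0; rewrite /gamma_integral.
rewrite (ge0_integral_split (fun t =>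
  expR (- t) * t `^ (s - 1)) 1) ?bnd_simp//; last 2 first.
- exact: measurable_gamma_integrand.
- by move=> t; rewrite mulr_ge0 ?expR_ge0 ?powR_ge0.
have [K [K0 HK]] := integral_expR_powR_y 1 (s - 1) ltr01.
apply: lte_add_pinfty; last first.
  apply: (@le_lt_trans _ _ K%:E); last by rewrite ltry.
  by move: HK; under eq_integral do rewrite mul1r.
apply: (@le_lt_trans _ _ (\int[mu]_(t in `]0%R, 1%R]) (t `^ (s - 1))%:E)%E).
  apply: ge0_le_integral_subset => // t /=; rewrite in_itv/= => /andP[t0 t1];
    rewrite ?mulr_ge0 ?expR_ge0 ?powR_ge0//.
  by rewrite ler_piMl ?powR_ge0// expR_le1; lra.
by apply: (le_lt_trans (integral_powR_0 _ _ _ _)); rewrite ?ltry//; lra.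
Qed.

Lemma Gamma_integralE s : 0 < s -> (Gamma s)%:E = gamma_integral s.
Proof.
move=> s0; rewrite /Gamma /Rintegral fineK// ge0_fin_numE ?gamma_integral_lty//.
exact: gamma_integral_ge0.
Qed.

Lemma Gamma_gt0 s : 0 < s -> 0 < Gamma s.
Proof.
move=> s0; rewrite -lte_fin Gamma_integralE//.
pose k : R := expR (- 2) * 2 `^ (- `|s - 1|).
have k0 : 0 < k by rewrite mulr_gt0 ?expR_gt0 ?powR_gt0.
apply: (@lt_le_trans _ _ (k * (2 - 1))%:E); first by rewrite lte_fin; lra.
apply: ge0_integral_ge_cst; [lra|exact: ltW| | |].
- by move=> t /=; rewrite !in_itv/= andbT; lra.
- by move=> t _; rewrite mulr_ge0 ?expR_ge0 ?powR_ge0.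
move=> t /andP[t1 t2]; rewrite ler_pM ?expR_ge0 ?powR_ge0 ?ler_expR//;
  first lra.
rewrite powRN -[leLHS]mulr1 ler_pdivrMl ?powR_gt0//.
have := @powR_comparable R 2 (s - 1) 1 t; rewrite powR1 /=; apply; lra.
Qed.

Lemma integral_gamma_parts s (a b : R) : 0 < s -> 0 < a -> a < b ->
  (\int[mu]_(t in `[a, b]) (expR (- t) * t `^ s)%:E =
   (a `^ s * expR (- a) - b `^ s * expR (- b))%:E +
   s%:E * \int[mu]_(t in `[a, b]) (expR (- t) * t `^ (s - 1))%:E)%E.
Proof.
move=> s0 a0 ab.
have dexp (x : R) : is_derive x 1%R (fun t : R => expR (- t)) (- expR (- x)).
  have -> : (fun t : R => expR (- t)) = expR \o -%R by [].
  by apply: is_derive_eq; rewrite mulrN1.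
have cexp (x : R) : {for x, continuous (fun t : R => expR (- t))}.
  by apply: continuous_comp; [exact: continuousN|exact: continuous_expR].
have dpow (x : R) : 0 < x -> is_derive x 1%R (@powR R ^~ s) (s * x `^ (s - 1)).
  exact: is_derive1_powR.
have cpow p (x : R) : 0 < x -> {for x, continuous (@powR R ^~ p)}.
  exact: continuous_powR.
have dG (x : R) : 0 < x -> is_derive x 1%R (fun t : R =>
  - expR (- t)) (expR (- x)).
  by move=> _; apply: (is_derive_eq (is_deriveN _)); rewrite opprK.
have [LF Ff] := gt0_derivable_LRcontinuous _ _ _ _ a0 ab dpow.
have [LG Gf] := gt0_derivable_LRcontinuous _ _ _ _ a0 ab dG.
under eq_integral do rewrite mulrC.
rewrite (integration_by_parts ab _ LF Ff _ LG Gf); last 2 first.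
- by apply: continuous_gt0_within => // x x0; apply: continuousM;
    [exact: cst_continuous|exact: cpow].
- by apply: continuous_gt0_within => // x x0; exact: cexp.
have -> : (\int[mu]_(x in `[a, b]) (s * x `^ (s - 1) * - expR (- x))%:E =
   - (s%:E * \int[mu]_(t in `[a, b]) (expR (- t) * t `^ (s - 1))%:E))%E.
  under eq_integral do rewrite mulrN mulrAC -mulrA EFinN EFinM.
  rewrite integral_ge0N; last first.
    by move=> t _; rewrite mule_ge0// lee_fin ?mulr_ge0 ?expR_ge0 ?powR_ge0
      ?(ltW s0).
  congr (- _)%E; rewrite ge0_integralZl_EFin//=.
  - by move=> t _; rewrite lee_fin mulr_ge0 ?expR_ge0 ?powR_ge0.
  - by apply/measurable_EFinP; apply: measurable_funTS;
      exact: measurable_gamma_integrand.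
  - exact: ltW.
by rewrite oppeK; congr (_ + _)%E; congr EFin; ring.
Qed.

(** Integration by parts on a segment from a to b has the boundary terms
    a^s e^(-a) and b^s e^(-b). Taking a small, respectively b large, makes one
    of them negligible while the other has a favourable sign: this gives the
    two inequalities. *)
Lemma Gamma_rec s : 0 < s -> Gamma (s + 1) = s * Gamma s.
Proof.
move=> s0; have s10 : 0 < s + 1 by lra.
have h0 p (x : R) : 0 <= expR (- x) * x `^ p.
  by rewrite mulr_ge0 ?expR_ge0 ?powR_ge0.
have sub0y (a b : R) : 0 < a -> `[a, b]%classic `<=` `]0, +oo[%classic.
  by move=> a0 x /=; rewrite !in_itv/= andbT => /andP[+ _]; exact: lt_le_trans.
have parts : forall a b : R, 0 < a -> a < b -> exists r1 r2 : R,
    [/\ (\int[mu]_(t in `[a, b]) (expR (- t) * t `^ s)%:E = r1%:E)%E,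
      (\int[mu]_(t in `[a, b]) (expR (- t) * t `^ (s - 1))%:E = r2%:E)%E,
      r1 <= Gamma (s + 1), r2 <= Gamma s & 
      r1 = a `^ s * expR (- a) - b `^ s * expR (- b) + s * r2].
  move=> a b a0 ab.
  have r1le : (\int[mu]_(t in `[a,
    b]) (expR (- t) * t `^ s)%:E <= (Gamma (s + 1))%:E)%E.
    rewrite Gamma_integralE// /gamma_integral addrK.
    by apply: ge0_le_integral_subset => //; exact: sub0y.
  have r2le : (\int[mu]_(t in `[a,
    b]) (expR (- t) * t `^ (s - 1))%:E <= (Gamma s)%:E)%E.
    rewrite Gamma_integralE// /gamma_integral.
    by apply: ge0_le_integral_subset => //; exact: sub0y.
  have := integral_gamma_parts s a b s0 a0 ab.
  have : (0 <= \int[mu]_(t in `[a, b]) (expR (- t) * t `^ (s - 1))%:E)%E.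
    by apply: integral_ge0 => x _; rewrite lee_fin.
  move: r1le r2le.
  case: (\int[mu]_(t in _) _)%E => [r1||];
    case: (\int[mu]_(t in _) _)%E => [r2||]//.
  move=> r1le r2le _ [E]; exists r1, r2; split=> //.
have le1 : Gamma (s + 1) <= s * Gamma s.
  apply/ler_addgt0Pr => e e0;
    rewrite -lee_fin Gamma_integralE// /gamma_integral addrK.
  apply: ge0_integral_le_compact => //; first exact: measurable_gamma_integrand.
  (* to the left of e^(1/s) the boundary term t^s e^(-t) is at most e *)
  move=> u v u0 uv; pose c := Num.min u (e `^ s^-1).
  have ee0 : 0 < e `^ s^-1 by rewrite powR_gt0.
  have c0 : 0 < c by rewrite lt_min u0.
  have cu : c <= u by rewrite ge_min lexx.
  have ce : c <= e `^ s^-1 by rewrite ge_min lexx orbT.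
  have [r1 [r2 [E1 _ _ r2G E]]] := parts c v c0 (le_lt_trans cu uv).
  apply: (@le_trans _ _ r1%:E).
    rewrite -E1; apply: ge0_le_integral_subset => // x [_] /=.
    by rewrite !in_itv/=; lra.
  rewrite lee_fin E.
  have ces : c `^ s <= e.
    apply: (le_trans (powR_le_base s _ _ _ _ ce)); [lra|lra|].
    by rewrite -powRrM mulVf ?gt_eqF// powRr1// ltW.
  have : c `^ s * expR (- c) <= e.
    by apply: le_trans ces; rewrite ler_piMr ?powR_ge0// expR_le1; lra.
  have : 0 <= v `^ s * expR (- v) by rewrite mulr_ge0 ?expR_ge0 ?powR_ge0.
  have : s * r2 <= s * Gamma s by rewrite ler_wpM2l// ltW.
  by lra.
apply/eqP; rewrite eq_le le1/=.
rewrite mulrC -ler_pdivlMr//.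
apply/ler_addgt0Pr => e e0;
  rewrite -lee_fin Gamma_integralE// {1}/gamma_integral.
apply: ge0_integral_le_compact => //; first exact: measurable_gamma_integrand.
have [C [C0 HC]] := powR_le_expR s (1 / 2) (ltW s0) ltac:(lra).
(* t^s e^(-t) <= C e^(- t/2) <= 2 C / t, which is at most e s from here on *)
move=> u v u0 uv; pose c := Num.max v (2 * C / (e * s)).
have es0 : 0 < e * s by rewrite mulr_gt0.
have cv : v <= c by rewrite le_max lexx.
have ce : 2 * C / (e * s) <= c by rewrite le_max lexx orbT.
have [r1 [r2 [_ E2 r1G _ E]]] := parts u c u0 (lt_le_trans uv cv).
apply: (@le_trans _ _ r2%:E).
  rewrite -E2; apply: ge0_le_integral_subset => // x [_] /=.
  by rewrite !in_itv/=; lra.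
have c0 : 0 < c by lra.
have small : c `^ s * expR (- c) <= e * s.
  rewrite expRN ler_pdivrMr ?expR_gt0//; apply: (le_trans (HC _ c0)).
  have -> : expR c = expR (1 / 2 * c) * expR (1 / 2 * c).
    by rewrite -expRD; congr expR; field.
  rewrite mulrA ler_wpM2r ?expR_ge0//.
  have : C <= e * s * (1 / 2 * c).
    by move: ce; rewrite ler_pdivrMr//; lra.
  move=> /le_trans; apply; rewrite ler_wpM2l ?(ltW es0)//.
  by have := expR_ge1Dx (1 / 2 * c); lra.
rewrite lee_fin -(ler_pM2r s0) mulrDl divfK ?gt_eqF//.
have : 0 <= u `^ s * expR (- u) by rewrite mulr_ge0 ?expR_ge0 ?powR_ge0.
by lra.
Qed.
End GammaFacts.

(** * Sequences with ratio (k + 1 + p) / (k + 1 + q) *)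
Section RatioAsymptotics.
Context {R : realType}.
Implicit Types p q x : R.

(** The inequality [ln (1 + y) <= y], used at [y] and at [- y / (1 + y)],
    encloses the logarithm. *)
Lemma ln1Dx_linear p : -1 < p ->
  exists C, 0 < C /\ forall x, 0 <= x -> x <= 1 ->
    `|ln (1 + p * x) - p * x| <= C * x ^+ 2.
Proof.
move=> p1; pose m := Num.min 1 (1 + p).
have m0 : 0 < m by rewrite lt_min ltr01/=; lra.
exists (p ^+ 2 / m + 1); split;
  first by rewrite ltr_wpDl ?divr_ge0 ?sqr_ge0 ?ltW.
move=> x x0 x1; set y := p * x.
have ym : m <= 1 + y.
  rewrite /y; have [p0|p0] := leP 0 p.
    by rewrite ge_min; apply/orP; left; rewrite lerDl mulr_ge0.
  rewrite ge_min; apply/orP; right; rewrite lerD2l.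
  by have : p * x >= p * 1 by [rewrite ler_wnM2l// ltW]; rewrite mulr1.
have y1 : 0 < 1 + y by lra.
have le1 : ln (1 + y) <= y by apply: le_ln1Dx; lra.
have le2 : y - y ^+ 2 / m <= ln (1 + y).
  have : ln (1 + (- y / (1 + y))) <= - y / (1 + y).
    by apply: le_ln1Dx; rewrite mulNr ltrN2 ltr_pdivrMr//; lra.
  have -> : 1 + - y / (1 + y) = (1 + y)^-1 by field; lra.
  rewrite lnV ?posrE// lerNl => h; apply: le_trans h.
  have -> : - (- y / (1 + y)) = y - y ^+ 2 / (1 + y) by field; lra.
  rewrite lerD2l lerN2 ler_wpM2l ?sqr_ge0// lef_pV2 ?posrE//.
rewrite ler_norml; apply/andP; split; last first.
  by rewrite (@le_trans _ _ 0)//;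
    [lra|rewrite mulr_ge0 ?sqr_ge0// addr_ge0// divr_ge0 ?sqr_ge0 ?ltW].
have -> : (p ^+ 2 / m + 1) * x ^+ 2 = y ^+ 2 / m + x ^+ 2.
  by rewrite /y; field; lra.
by have := sqr_ge0 x; lra.
Qed.

(** With x = 1 / (k + 1), the increments of ln (u k) - (p - q) ln (k + 1) are
    a combination of the functions ln (1 + r x) for r = p, q, 1, in which the
    linear terms cancel. They are O(x^2), hence summable, and the sequence
    stays bounded. *)
Lemma ratio_asymptotics (u : nat -> R) p q : -1 < p -> -1 < q -> 0 < u 0%N ->
  (forall k, u k.+1 * (k%:R + 1 + q) = u k * (k%:R + 1 + p)) ->
  exists C, 0 < C /\ forall k, C^-1 * (k%:R + 1) `^ (p - q) <= u k /\
                               u k <= C * (k%:R + 1) `^ (p - q).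
Proof.
move=> p1 q1 u0 urec.
have k0 k : 0 <= k%:R :> R by [].
have ugt k : 0 < u k.
  elim: k => // k IH; have := urec k; have := k0 k => kk E.
  rewrite -(pmulr_lgt0 _ (_ : 0 < k%:R + 1 + q)); last lra.
  by rewrite E mulr_gt0//; lra.
have [Cp [Cp0 HCp]] := ln1Dx_linear p p1.
have [Cq [Cq0 HCq]] := ln1Dx_linear q q1.
have [C1 [C10 HC1]] := ln1Dx_linear 1 ltac:(lra).
pose K := Cp + Cq + `|p - q| * C1.
have K0 : 0 <= K by rewrite addr_ge0 ?mulr_ge0 ?normr_ge0//; lra.
pose D k := ln (u k) - (p - q) * ln (k%:R + 1).
have Dstep k : `|D k.+1 - D k| <= K * (k%:R + 1)^-1 ^+ 2.
  have kk := k0 k; have k1 : 0 < k%:R + 1 :> R by lra.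
  set x := (k%:R + 1)^-1; have x0 : 0 < x by rewrite invr_gt0.
  have x1 : x <= 1 by rewrite invf_le1//; lra.
  have xk : x * (k%:R + 1) = 1 by rewrite mulVf// gt_eqF.
  have px : -1 < p * x.
    have : 0 < x * (k%:R + 1 + p) by rewrite mulr_gt0//; lra.
    by rewrite mulrDr xk; lra.
  have qx : -1 < q * x.
    have : 0 < x * (k%:R + 1 + q) by rewrite mulr_gt0//; lra.
    by rewrite mulrDr xk; lra.
  have -> : D k.+1 - D k = (ln (1 + p * x) - p * x) - (ln (1 + q * x) - q * x)
       - (p - q) * (ln (1 + 1 * x) - 1 * x).
    have -> : D k.+1 = ln (u k) + ln (1 + p * x) - ln (1 + q * x)
       - (p - q) * (ln (k%:R + 1) + ln (1 + 1 * x)).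
      rewrite /D; congr (_ - _ * _).
        rewrite -lnM ?posrE//; last lra.
        rewrite -ln_div ?posrE//; [|rewrite mulr_gt0//; lra|lra].
        congr ln; have e1 : 1 + p * x = x * (k%:R + 1 + p) by rewrite mulrDr
          xk; ring.
        have e2 : 1 + q * x = x * (k%:R + 1 + q) by rewrite mulrDr xk; ring.
        rewrite e1 e2 mulrCA -urec; field.
        by rewrite !gt_eqF//; lra.
      rewrite -lnM ?posrE//; last lra.
      by congr ln; rewrite mul1r mulrDr mulr1 mulrC xk -natr1; ring.
    by rewrite /D; ring.
  apply: (le_trans (ler_normB _ _)).
  have -> : K * x ^+ 2 = Cp * x ^+ 2 + Cq * x ^+ 2 + `|p - q| * (C1 * x ^+ 2).
    by rewrite /K; ring.
  apply: lerD; last by rewrite normrM ler_wpM2l// HC1// ltW.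
  by apply: (le_trans (ler_normB _ _)); rewrite lerD ?HCp ?HCq// ltW.
(* 1 / (k + 1)^2 <= 2 (1 / (k + 1) - 1 / (k + 2)), which telescopes *)
have Dbnd k : `|D k| <= `|D 0%N| + 2 * K * (1 - (k%:R + 1)^-1).
  elim: k => [|k IH]; first by rewrite add0r invr1 subrr mulr0 addr0.
  have -> : D k.+1 = D k + (D k.+1 - D k) by ring.
  apply: (le_trans (ler_normD _ _)).
  apply: (le_trans (lerD IH (Dstep k))).
  rewrite -addrA lerD2l -[k.+1%:R]natr1 -subr_ge0.
  have kk := k0 k; set r : R := k%:R in kk *.
  have -> : 2 * K * (1 - (r + 1 + 1)^-1) - (2 * K * (1 - (r + 1)^-1) + K * (r +
    1)^-1 ^+ 2)
     = K * (r / ((r + 1) ^+ 2 * (r + 2))).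
    by field; apply/andP; split; rewrite gt_eqF//; lra.
  rewrite mulr_ge0// divr_ge0// mulr_ge0 ?sqr_ge0//; lra.
pose M : R := `|D 0%N| + 2 * K.
have DM k : `|D k| <= M.
  apply: (le_trans (Dbnd k)); rewrite lerD2l mulrBr mulr1.
  have : 0 <= 2 * K * (k%:R + 1)^-1.
    by rewrite !mulr_ge0// invr_ge0 addr_ge0.
  by lra.
have uE k : u k = expR (D k) * (k%:R + 1) `^ (p - q).
  have kk := k0 k; have k1 : 0 < k%:R + 1 :> R by lra.
  by rewrite {1}/powR gt_eqF// -expRD /D subrK lnK ?posrE.
exists (expR M); split; first exact: expR_gt0.
move=> k; have := DM k; rewrite ler_norml => /andP[l1 l2]; rewrite uE -expRN.
by split; rewrite ler_wpM2r ?powR_ge0// ler_expR.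
Qed.
End RatioAsymptotics.

(** * Moments of the weights z^(2k) / (2k)! *)
Section PoissonMoments.
Context {R : realType}.
Implicit Types z b : R.

Definition cosh_coeff z (k : nat) : R := z ^+ (2 * k) / (2 * k)`!%:R.

Lemma cosh_coeff_ge0 z k : 0 <= z -> 0 <= cosh_coeff z k.
Proof. by move=> z0; rewrite divr_ge0// exprn_ge0. Qed.

Lemma cosh_coeffM z c k : cosh_coeff (z * c) k = cosh_coeff z k * (c ^+ 2) ^+ k.
Proof. by rewrite /cosh_coeff exprMn -exprM mulrAC. Qed.

(** Add the partial sums of even length of the exponential series at [z] and
    [- z]: the odd terms cancel. *)
Lemma cvg_cosh_series z :
  series (cosh_coeff z) @ \oo --> (expR z + expR (- z)) / 2.
Proof.
have E n : series (cosh_coeff z) n =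
    (series (exp_coeff z) (2 * n)%N + series (exp_coeff (- z)) (2 * n)%N) / 2.
  elim: n => [|n IH]; first by rewrite !seriesEnat/= muln0 !big_geq// addr0
    mul0r.
  rewrite mulnS !seriesSr IH /exp_coeff/= /cosh_coeff.
  rewrite !exprS !exprM sqrrN; field.
  by apply/andP; split; rewrite pnatr_eq0 -lt0n fact_gt0.
have c2 : (fun n => 2 * n)%N @ \oo --> \oo.
  move=> P [N _ NP]; exists N => // n /= Nn; apply: NP => /=.
  by apply: (leq_trans Nn); rewrite leq_pmull.
rewrite (_ : series (cosh_coeff z) = (fun n => 
    (series (exp_coeff z) (2 * n)%N + series (exp_coeff (- z)) (2 * n)%N) /
      2)); last exact/funext.
apply: cvgMl; apply: cvgD.
  by apply: (cvg_comp _ _ c2); exact: is_cvg_series_exp_coeff.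
by apply: (cvg_comp _ _ c2); exact: is_cvg_series_exp_coeff.
Qed.

Lemma cosh_series_le z n : 0 <= z -> \sum_(0 <= k < n) cosh_coeff z k <= expR z.
Proof.
move=> z0; apply: (@le_trans _ _ ((expR z + expR (- z)) / 2)); last first.
  have : expR (- z) <= expR z by rewrite ler_expR; lra.
  by lra.
rewrite -(cvg_lim _ (cvg_cosh_series z))//.
apply: (@nondecreasing_cvgn_le _ (series (cosh_coeff z))).
  by apply: nondecreasing_series => k _ _; exact: cosh_coeff_ge0.
by apply/cvg_ex; eexists; exact: cvg_cosh_series.
Qed.

Lemma cosh_series_ge z : exists n,
  expR z / 2 <= \sum_(0 <= k < n) cosh_coeff z k.
Proof.
have h : expR z / 2 < (expR z + expR (- z)) / 2 by have := expR_gt0 (- z); lra.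
have := cvgr_ge _ (cvg_cosh_series z) _ h.
by case=> N _ /(_ N (leqnn N)); exists N.
Qed.

(** Put u = (k + 1) / (1 + z). The first term covers u >= 1 and the second one
    1/8 <= u < 1. For u < 1/8 the crude bound 1/u <= 1 + z suffices, times an
    exponential that is at least 1 there and decays in [k]. *)
Lemma powR_split_bound b : exists C, 0 < C /\ forall z (k : nat), 0 < z ->
  ((k%:R + 1) / (1 + z)) `^ (- b) <=
  C * expR ((k%:R + 1) / (1 + z)) + 8 `^ `|b|
    + (1 + z) `^ `|b| * expR ((1 + z) / 4 - 2 * (k%:R + 1)).
Proof.
have [C [C0 HC]] := powR_le_expR `|b| 1 (normr_ge0 _) ltr01.
exists C; split => // z k z0.
have k1 : 1 <= k%:R + 1 :> R by rewrite lerDr.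
have z1 : 0 < 1 + z by lra.
set u := (k%:R + 1) / (1 + z).
have u0 : 0 < u by rewrite divr_gt0//; lra.
have T1 : 0 <= C * expR u by rewrite mulr_ge0 ?expR_ge0 ?ltW.
have T2 : 0 <= 8 `^ `|b| :> R by exact: powR_ge0.
have T3 : 0 <= (1 + z) `^ `|b| * expR ((1 + z) / 4 - 2 * (k%:R + 1)).
  by rewrite mulr_ge0 ?powR_ge0 ?expR_ge0.
have [u1|u1] := leP 1 u.
  have : u `^ (- b) <= u `^ `|b| by apply: ler_powR => //;
    rewrite ler_normr lexx orbT.
  have := HC u u0; rewrite mul1r; lra.
have ub : u `^ (- b) <= u^-1 `^ `|b|.
  rewrite -powR_inv1 ?(ltW u0)// -powRrM mulN1r.
  by apply: ger_powR; [lra|rewrite lerN2 ler_norm].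
have [u8|u8] := leP u^-1 8.
  have : u^-1 `^ `|b| <= 8 `^ `|b|.
    by apply: powR_le_base => //; rewrite invr_ge0 ltW.
  by lra.
have uz : u^-1 <= 1 + z.
  by rewrite invf_div ler_pdivrMr; [rewrite ler_peMr//; lra|lra].
have kz : 8 * (k%:R + 1) < 1 + z.
  by move: u8; rewrite invf_div ltr_pdivlMr//; lra.
have : u^-1 `^ `|b| <= (1 + z) `^ `|b|.
  by apply: powR_le_base => //; rewrite invr_ge0 ltW.
have : (1 + z) `^ `|b| * 1 <= (1 + z) `^ `|b|
  * expR ((1 + z) / 4 - 2 * (k%:R + 1)).
  rewrite ler_wpM2l ?powR_ge0//.
  by have := expR_ge1Dx ((1 + z) / 4 - 2 * (k%:R + 1)); lra.
by rewrite mulr1; lra.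
Qed.

(** Chernoff method: the factors of [powR_split_bound] that are exponential in
    [k] only rescale [z], and [cosh_series_le] sums the rescaled weights. *)
Lemma poisson_moment_le b : exists C, 0 < C /\ forall z n, 0 < z ->
  \sum_(0 <= k < n) cosh_coeff z k * ((k%:R + 1) / (1 + z)) `^ (- b) <=
  C * expR z.
Proof.
have [C [C0 HC]] := powR_split_bound b.
have [C2 [C20 HC2]] := powR_le_expR `|b| (1 / 4) (normr_ge0 _) ltac:(lra).
exists (C * expR 2 + 8 `^ `|b| + C2 * expR 1); split.
  by rewrite ltr_wpDl ?mulr_gt0 ?expR_gt0// addr_ge0 ?powR_ge0// mulr_ge0
    ?expR_ge0// ltW.
move=> z n z0.
have z1 : 0 < 1 + z by lra.
have expk (c : R) (k : nat) :
  expR (c * (k%:R + 1)) = expR c * (expR (c / 2) ^+ 2) ^+ k.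
  by rewrite -exprM -expRM_natr -expRD natrM; congr expR; field.
apply: (@le_trans _ _ (\sum_(0 <= k < n) (
    C * expR (1 + z)^-1 * cosh_coeff (z * expR ((1 + z)^-1 / 2)) k
    + 8 `^ `|b| * cosh_coeff z k
    + (1 + z) `^ `|b| * expR ((1 + z) / 4 - 2) * cosh_coeff (z * expR (- 1))
        k))).
  apply: ler_sum_nat => k _.
  apply: (le_trans (ler_wpM2l (cosh_coeff_ge0 _ k (ltW z0)) (HC z k z0))).
  rewrite !cosh_coeffM (mulrC (k%:R + 1)) expk expRD -mulNr expk expRD.
  rewrite (_ : - (2) / 2 = - 1 :> R); last by field.
  by rewrite le_eqVlt; apply/orP; left; apply/eqP; ring.
rewrite !big_split/= -!mulr_sumr.
have y0 : 0 < (1 + z)^-1 by rewrite invr_gt0.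
have y1 : (1 + z)^-1 <= 1 by rewrite invf_le1//; lra.
have yz : (1 + z)^-1 * (1 + z) = 1 by rewrite mulVf// gt_eqF.
set y := (1 + z)^-1 in y0 y1 yz *.
(* the rescaling by e^(y/2) costs only a bounded factor since y (1 + z) = 1 *)
have ey : z * expR (y / 2) <= z + 1.
  have e1 : expR (y / 2) <= 1 + y.
    have := expR_ge1Dx (- (y / 2)); rewrite expRN => h.
    have h1 : expR (y / 2) * (1 - y / 2) <= 1.
      by rewrite -ler_pdivlMl ?expR_gt0// mulr1.
    have h2 : 1 <= (1 + y) * (1 - y / 2) by nra.
    have h3 : 0 < 1 - y / 2 by lra.
    by rewrite -(ler_pM2r h3); lra.
  have : z * expR (y / 2) <= z * (1 + y) by rewrite ler_wpM2l// ltW.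
  have : y * (1 + z) = y + z * y by ring.
  by rewrite mulrDr mulr1; lra.
rewrite [leRHS]mulrDl [X in _ <= X + _]mulrDl.
apply: lerD; first apply: lerD.
- rewrite -!mulrA ler_wpM2l ?(ltW C0)// -expRD.
  apply: (@le_trans _ _ (expR y * expR (z * expR (y / 2)))).
    by rewrite ler_wpM2l ?expR_ge0// cosh_series_le// mulr_ge0 ?expR_ge0// ltW.
  by rewrite -expRD ler_expR; lra.
- by rewrite ler_wpM2l ?powR_ge0// cosh_series_le// ltW.
have e1 : expR (-1) <= 1 / 2 :> R.
  have := expR_ge1Dx (1 : R) => h;
    rewrite expRN div1r lef_pV2 ?posrE ?expR_gt0//; lra.
apply: (@le_trans _ _ (C2 * expR (1 / 4 * (1 + z)) * expR ((1 + z) / 4 - 2)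
    * expR (z / 2))).
  apply: ler_pM; rewrite ?mulr_ge0 ?powR_ge0 ?expR_ge0//.
  - by apply: sumr_ge0 => k _; rewrite cosh_coeff_ge0// mulr_ge0 ?expR_ge0 ?ltW.
  - by rewrite ler_wpM2r ?expR_ge0// HC2.
  - apply: (le_trans (cosh_series_le _ _ _));
      first by rewrite mulr_ge0 ?expR_ge0 ?ltW.
    by rewrite ler_expR; have :
      z * expR (-1) <= z * (1 / 2) by [rewrite ler_wpM2l// ltW|]; lra.
by rewrite -!mulrA -!expRD ler_wpM2l ?(ltW C20)// ler_expR; lra.
Qed.

(** Duality with the upper bound for the opposite exponent: v >= 2 e - e^2 / v
    for all v, e > 0, so that an upper bound for the moment of 1 / v gives a
    lower bound for the moment of v once e is small. *)
Lemma poisson_moment_ge b : exists C, 0 < C /\ forall z, 0 < z -> exists n,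
  C * expR z <=
  \sum_(0 <= k < n) cosh_coeff z k * ((k%:R + 1) / (1 + z)) `^ (- b).
Proof.
have [C [C0 HC]] := poisson_moment_le (- b).
exists (4 * C)^-1; split; first by rewrite invr_gt0; lra.
move=> z z0; have [n Hn] := cosh_series_ge z; exists n.
pose e := (2 * C)^-1; have e0 : 0 < e by rewrite invr_gt0; lra.
have Ce : C * e = 1 / 2 by rewrite /e; field; lra.
apply: (@le_trans _ _ (\sum_(0 <= k < n)
   (2 * e * cosh_coeff z k
    - e ^+ 2 * (cosh_coeff z k * ((k%:R + 1) / (1 + z)) `^ (- - b))))).
  rewrite sumrB -!mulr_sumr.
  have h1 := ler_wpM2l (sqr_ge0 e) (HC z n z0).
  have h2 : 2 * e * (expR z / 2) <= 2 * e * \sum_(0 <= k < n) cosh_coeff z k.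
    by rewrite ler_wpM2l//; lra.
  have h3 : e ^+ 2 * (C * expR z) = e / 2 * expR z.
    by rewrite mulrA expr2 -(mulrA e) (mulrC e C) Ce; field.
  have h4 : (4 * C)^-1 * expR z = e / 2 * expR z by rewrite /e; field; lra.
  by lra.
apply: ler_sum_nat => k _.
set v := _ `^ (- b).
have v0 : 0 < v.
  by rewrite powR_gt0// divr_gt0 ?ltr_wpDl//; lra.
rewrite (powRN _ (- b)) -/v.
have p0 := cosh_coeff_ge0 z k (ltW z0).
have -> : 2 * e * cosh_coeff z k - e ^+ 2 * (cosh_coeff z k / v) =
   cosh_coeff z k * (2 * e - e ^+ 2 / v) by ring.
rewrite ler_wpM2l// -subr_ge0.
have -> : v - (2 * e - e ^+ 2 / v) = (v - e) ^+ 2 / v by field; lra.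
by rewrite divr_ge0 ?sqr_ge0 ?ltW.
Qed.
End PoissonMoments.

(** * Two-sided bounds for the Bessel function and the heat kernel *)
Section BesselBounds.
Context {R : realType}.
Implicit Types alpha z t x y : R.

Lemma limn_series_bounds (f : R^nat) (M : R) : (forall k, 0 <= f k) ->
  (forall n, \sum_(0 <= k < n) f k <= M) ->
  limn (series f) <= M /\ forall n, \sum_(0 <= k < n) f k <= limn (series f).
Proof.
move=> f0 fM.
have nd : nondecreasing_seq (series f) by apply: nondecreasing_series => k _ _.
have cv : cvgn (series f).
  by apply: nondecreasing_is_cvgn => //; exists M => _ [n _ <-]; exact: fM.
split; first by apply: limr_le => //; apply: nearW => n; exact: fM.
by move=> n; exact: (nondecreasing_cvgn_le nd cv).
Qed.

(** Dividing the coefficients of the hyperbolic cosine by these weights yields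
    those of the Bessel function, up to the factor [(z / 2) `^ alpha]. *)
Definition bessel_weight alpha (k : nat) : R :=
  k`!%:R * Gamma (k%:R + alpha + 1) * 4 ^+ k / (2 * k)`!%:R.

(** By the functional equation of Gamma, consecutive weights have the ratio
    (k + 1 + alpha) / (k + 1/2). *)
Lemma bessel_weight_asymptotics alpha : -1 < alpha ->
  exists C, 0 < C /\ forall k,
    C^-1 * (k%:R + 1) `^ (alpha + 1 / 2) <= bessel_weight alpha k /\
    bessel_weight alpha k <= C * (k%:R + 1) `^ (alpha + 1 / 2).
Proof.
move=> a1; have -> : alpha + 1 / 2 = alpha - (- (1 / 2)) by ring.
apply: ratio_asymptotics => //; first lra.
  rewrite /bessel_weight fact0 add0r expr0 mul1r mulr1 divr1.
  by apply: Gamma_gt0; lra.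
move=> k; have k0 : 0 <= k%:R :> R by [].
have f0 : (2 * k)`!%:R != 0 :> R by rewrite pnatr_eq0 -lt0n fact_gt0.
rewrite /bessel_weight mulnS !factS exprS.
rewrite (_ : k.+1%:R + alpha + 1 = (k%:R + alpha + 1) + 1); last first.
  by rewrite -natr1; ring.
rewrite Gamma_rec; last lra.
rewrite !natrM -!natr1 natrM.
field.
by rewrite f0/=; apply/andP; split; rewrite gt_eqF//; lra.
Qed.

(** Put b = alpha + 1/2. Up to constants, the Bessel function is z^alpha times
    the sum over k of (k + 1)^(-b) z^(2k) / (2k)!, a moment of order
    (1 + z)^(-b) e^z. *)
Lemma besselI_bounds alpha : -1 < alpha ->
  exists C, 0 < C /\ forall z, 0 < z ->
    C^-1 * (z `^ alpha * (1 + z) `^ (- (alpha + 1 / 2)) * expR z)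
      <= besselI alpha z /\
    besselI alpha z
      <= C * (z `^ alpha * (1 + z) `^ (- (alpha + 1 / 2)) * expR z).
Proof.
move=> a1; set b := alpha + 1 / 2.
have [C [C0 HC]] := bessel_weight_asymptotics alpha a1.
have [C1 [C10 HC1]] := poisson_moment_le b.
have [C2 [C20 HC2]] := poisson_moment_ge b.
have a20 : 0 < 2 `^ (- alpha) :> R by rewrite powR_gt0.
pose M := 2 `^ (- alpha) * C * C1 + (2 `^ (- alpha) * C^-1 * C2)^-1.
have p1 : 0 < 2 `^ (- alpha) * C * C1 by rewrite !mulr_gt0.
have p2 : 0 < (2 `^ (- alpha) * C^-1 * C2)^-1 by rewrite invr_gt0 !mulr_gt0
  ?invr_gt0.
exists M; split; first by rewrite addr_gt0.
move=> z z0; have z1 : 0 < 1 + z by lra.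
set E := z `^ alpha * (1 + z) `^ (- b).
have E0 : 0 < E by rewrite mulr_gt0 ?powR_gt0.
rewrite /besselI; set f := (fun k : nat => _).
have kk (k : nat) : 0 < k%:R + 1 :> R by rewrite ltr_wpDl.
have fE k : f k = 2 `^ (- alpha) * z `^ alpha * (cosh_coeff z k / bessel_weight
  alpha k).
  have k0 : 0 <= k%:R :> R by [].
  rewrite /f /cosh_coeff /bessel_weight powRD_gt0 ?divr_gt0//.
  rewrite [_ `^ (2 * _)]powRrM.
  rewrite powR_mulrn ?powR_ge0// (powR_mulrn 2) ?divr_ge0 ?ltW//.
  rewrite powRM ?ltW// ?invr_ge0// -(powR_inv1 (ler0n _ 2)) -powRrM mulN1r.
  rewrite powR_inv1//.
  have -> : (4 : R) = 2 ^+ 2 by ring.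
  rewrite -!exprM expr_div_n.
  have G0 : Gamma (k%:R + alpha + 1) != 0 :> R by rewrite gt_eqF// Gamma_gt0//;
    lra.
  field; rewrite G0 /= !pnatr_eq0 -!lt0n !fact_gt0 /=.
  by rewrite expf_neq0.
have bE k : cosh_coeff z k * (k%:R + 1) `^ (- b) =
    (1 + z) `^ (- b) * (cosh_coeff z k * ((k%:R + 1) / (1 + z)) `^ (- b)).
  rewrite powRM ?invr_ge0 ?ltW// -(powR_inv1 (ltW z1)) -powRrM mulN1r opprK
    powRN.
  by rewrite [(1 + z) `^ (- b)]powRN; field; rewrite !gt_eqF ?powR_gt0.
have den0 k : 0 < bessel_weight alpha k.
  apply: lt_le_trans (proj1 (HC k)).
  by rewrite mulr_gt0 ?invr_gt0 ?powR_gt0.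
have fup k : f k <= 2 `^ (- alpha) * C * E *
    (cosh_coeff z k * ((k%:R + 1) / (1 + z)) `^ (- b)).
  rewrite fE /E.
  have -> : 2 `^ (- alpha) * C * (z `^ alpha * (1 + z) `^ (- b)) *
    (cosh_coeff z k * ((k%:R + 1) / (1 + z)) `^ (- b)) =
    2 `^ (- alpha) * z `^ alpha * (cosh_coeff z k * (C * (k%:R + 1) `^ (- b))).
    rewrite [cosh_coeff z k * (C * _)]mulrCA bE; ring.
  rewrite ler_wpM2l ?mulr_ge0 ?powR_ge0// ler_wpM2l ?cosh_coeff_ge0 ?(ltW z0)//.
  rewrite powRN -[C]invrK -invfM lef_pV2 ?posrE ?den0 ?mulr_gt0 ?invr_gt0
    ?powR_gt0//.
  exact: proj1 (HC k).
have flo k : 2 `^ (- alpha) * C^-1 * E *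
    (cosh_coeff z k * ((k%:R + 1) / (1 + z)) `^ (- b)) <= f k.
  rewrite fE /E.
  have -> : 2 `^ (- alpha) * C^-1 * (z `^ alpha * (1 + z) `^ (- b)) *
    (cosh_coeff z k * ((k%:R + 1) / (1 + z)) `^ (- b)) =
    2 `^ (- alpha) * z `^ alpha * (cosh_coeff z k * (C^-1 * (k%:R + 1) `^ (-
      b))).
    rewrite [cosh_coeff z k * (C^-1 * _)]mulrCA bE; ring.
  rewrite ler_wpM2l ?mulr_ge0 ?powR_ge0// ler_wpM2l ?cosh_coeff_ge0 ?(ltW z0)//.
  by rewrite powRN -invfM lef_pV2 ?posrE ?den0 ?mulr_gt0 ?powR_gt0//;
    exact: proj2 (HC k).
have f0 k : 0 <= f k.
  rewrite fE; apply: mulr_ge0; first by rewrite mulr_ge0 ?powR_ge0.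
  by apply: divr_ge0; [apply: cosh_coeff_ge0; exact: ltW|exact: ltW].
have fM n : \sum_(0 <= k < n) f k <= 2 `^ (- alpha) * C * C1 * (E * expR z).
  apply: (le_trans (ler_sum_nat (fun k _ => fup k))).
  rewrite -mulr_sumr.
  have -> : 2 `^ (- alpha) * C * C1 * (E * expR z) =
     2 `^ (- alpha) * C * E * (C1 * expR z) by ring.
  by rewrite ler_wpM2l ?mulr_ge0 ?powR_ge0 ?HC1 ?(ltW C0)// ltW.
have [L1 L2] := limn_series_bounds f _ f0 fM.
have Ez : 0 < E * expR z by rewrite mulr_gt0 ?expR_gt0.
split; last first.
  apply: (le_trans L1); rewrite ler_wpM2r ?(ltW Ez)// /M.
  by rewrite lerDl ltW.
have [n Hn] := HC2 z z0.
apply: (le_trans _ (L2 n)).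
apply: (le_trans _ (ler_sum_nat (fun k _ => flo k))).
rewrite -mulr_sumr.
apply: (@le_trans _ _ (2 `^ (- alpha) * C^-1 * E * (C2 * expR z))); last first.
  by rewrite ler_wpM2l// !mulr_ge0 ?powR_ge0 ?invr_ge0 ?(ltW C0).
have -> : 2 `^ (- alpha) * C^-1 * E * (C2 * expR z) =
   2 `^ (- alpha) * C^-1 * C2 * (E * expR z) by ring.
rewrite ler_wpM2r ?(ltW Ez)//.
rewrite -[leRHS]invrK lef_pV2 ?posrE ?addr_gt0//.
by rewrite /M lerDr ltW.
Qed.

(** Here [b] stands for alpha + 1/2, [s] for x + y and [d] for |x - y|. *)
Definition heat_envelope (b c s d t : R) : R :=
  t `^ (- (1 / 2)) * (t + s ^+ 2) `^ (- b) * expR (- (c * d ^+ 2 / t)).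

Lemma heat_envelope_ge0 (b c s d t : R) : 0 <= heat_envelope b c s d t.
Proof. by rewrite !mulr_ge0 ?powR_ge0 ?expR_ge0. Qed.

(** The bounds of the Bessel function give the size of the kernel as
    t^(-1/2) (2t + xy)^(-b) exp (- d^2 / (4t)). As 4xy = s^2 - d^2, the
    numbers 2t + xy and t + s^2 agree up to a factor 8 (1 + w) with w = d^2 /
    (8t); the powers of that factor are absorbed in e^w. This turns the
    constant 1/4 = 2/8 of the exponential into 3/8 below and 1/8 above. *)
Lemma besselW_bounds alpha : -1 < alpha ->
  exists C, 0 < C /\ forall t x y, 0 < t -> 0 < x -> 0 < y ->
    C^-1 * heat_envelope (alpha + 1 / 2) (3 / 8) (x + y) `|x - y|
      t <= besselW alpha t x y /\
    besselW alpha t x y <= C * heat_envelope (alpha + 1 / 2) (1 / 8) (x + y)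
      `|x - y| t.
Proof.
move=> a1; set b := alpha + 1 / 2.
have [C [C0 HC]] := besselI_bounds alpha a1.
have [C1 [C10 HC1]] := powR_le_expR `|b| (1 / 8) (normr_ge0 _) ltac:(lra).
have h20 : 0 < 2 `^ (- (1 / 2)) :> R by rewrite powR_gt0.
pose K := C1 * expR 1; have K0 : 0 < K by rewrite mulr_gt0 ?expR_gt0.
pose A := 2 `^ (- (1 / 2)) * C * K; pose B := 2 `^ (- (1 / 2)) * C^-1 * K^-1.
have A0 : 0 < A by rewrite !mulr_gt0.
have B0 : 0 < B by rewrite !mulr_gt0 ?invr_gt0.
exists (A + B^-1); split; first by rewrite addr_gt0 ?invr_gt0.
move=> t x y t0 x0 y0.
set d := `|x - y|; set s := x + y.
have d2 : d ^+ 2 = (x - y) ^+ 2 by rewrite /d real_normK// num_real.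
have xy0 : 0 < x * y by rewrite mulr_gt0.
pose z := x * y / (2 * t).
have t20 : 0 < 2 * t by lra.
have z0 : 0 < z by rewrite divr_gt0.
pose Z := (2 * t + x * y).
have Z0 : 0 < Z by rewrite addr_gt0.
have z1 : 1 + z = Z / (2 * t) by rewrite /z /Z; field; rewrite gt_eqF.
pose w := d ^+ 2 / (8 * t).
have w0 : 0 <= w by rewrite divr_ge0 ?sqr_ge0//; lra.
have wt : w * (8 * t) = d ^+ 2 by rewrite /w divfK// gt_eqF//; lra.
pose N := 2 `^ (- (1 / 2)) * (t `^ (- (1 / 2)) * Z `^ (- b) * expR (- (w + w))).
have main : (2 * t)^-1 * expR (- ((x ^+ 2 + y ^+ 2) / (4 * t))) * (x * y) `^ (-
  alpha)
     * (z `^ alpha * (1 + z) `^ (- b) * expR z) = N.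
  have e1 : (x * y) `^ (- alpha) * z `^ alpha = (2 * t) `^ (- alpha).
    rewrite /z [(_ / _) `^ _]powRM ?invr_ge0 ?(ltW xy0) ?(ltW t20)//.
    rewrite -(powR_inv1 (ltW t20)) -powRrM mulN1r mulrA -powRD_gt0// addNr
      powRr0.
    by rewrite mul1r.
  have e2 : (1 + z) `^ (- b) = Z `^ (- b) * (2 * t) `^ b.
    rewrite z1 powRM ?invr_ge0 ?(ltW Z0) ?(ltW t20)//.
    by rewrite -(powR_inv1 (ltW t20)) -powRrM mulN1r opprK.
  have e3 : (2 * t)^-1 * (2 * t) `^ (- alpha) * (2 * t) `^ b =
      2 `^ (- (1 / 2)) * t `^ (- (1 / 2)).
    rewrite -(powR_inv1 (ltW t20)) -!powRD_gt0// -powRM ?(ltW t0)//;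
      congr (_ `^ _).
    by rewrite /b; field.
  have e4 : expR (- ((x ^+ 2 + y ^+ 2) / (4 * t))) * expR z = expR (- (w + w)).
    rewrite -expRD; congr expR; rewrite /z /w d2; field.
    by rewrite gt_eqF.
  rewrite /N -e4.
  transitivity ((2 * t)^-1 * ((x * y) `^ (- alpha) * z `^ alpha) *
     (1 + z) `^ (- b) *
     (expR (- ((x ^+ 2 + y ^+ 2) / (4 * t))) * expR z)); first by ring.
  by rewrite e1 e2 [Z `^ _ * _]mulrC [_ * (_ * Z `^ _)]mulrA e3; ring.
have xy4 : 4 * (x * y) = s ^+ 2 - d ^+ 2 by rewrite d2 /s; ring.
have ts0 : 0 < t + s ^+ 2 by rewrite ltr_wpDr ?sqr_ge0.
have wt0 : 0 <= w * t by rewrite mulr_ge0// ltW.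
have wxy0 : 0 <= w * (x * y) by rewrite mulr_ge0// ltW.
have c1 : Z <= 8 * (1 + w) * (t + s ^+ 2).
  have : 0 <= w * s ^+ 2 by rewrite mulr_ge0// sqr_ge0.
  have := sqr_ge0 d; rewrite /Z; lra.
have c2 : t + s ^+ 2 <= 8 * (1 + w) * Z.
  rewrite /Z; lra.
have w81 : 0 < 8 * (1 + w) by lra.
have KB : (8 * (1 + w)) `^ `|b| <= K * expR w.
  apply: (le_trans (HC1 _ w81)); rewrite /K -mulrA -expRD.
  by rewrite ler_wpM2l ?(ltW C10)// ler_expR; lra.
have up : Z `^ (- b) <= K * expR w * (t + s ^+ 2) `^ (- b).
  have := powR_comparable (8 * (1 + w)) (- b) Z (t + s ^+ 2) Z0 ts0 c1 c2.
  rewrite normrN => h; apply: (le_trans h).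
  by rewrite ler_wpM2r ?powR_ge0.
have lo : (t + s ^+ 2) `^ (- b) <= K * expR w * Z `^ (- b).
  have := powR_comparable (8 * (1 + w)) (- b) (t + s ^+ 2) Z ts0 Z0 c2 c1.
  rewrite normrN => h; apply: (le_trans h).
  by rewrite ler_wpM2r ?powR_ge0.
have [I1 I2] := HC z z0.
have q0 : 0 <= (2 * t)^-1 * expR (- ((x ^+ 2 + y ^+ 2) / (4 * t))) * (x * y) `^
  (- alpha).
  by rewrite !mulr_ge0 ?expR_ge0 ?powR_ge0 ?invr_ge0 ?(ltW t20).
have W1 : besselW alpha t x y <= C * N.
  by rewrite -main mulrCA; exact: ler_wpM2l.
have W2 : C^-1 * N <= besselW alpha t x y.
  by rewrite -main mulrCA; exact: ler_wpM2l.
have th0 : 0 <= t `^ (- (1 / 2)) by exact: powR_ge0.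
split.
- apply: le_trans W2.
  apply: (@le_trans _ _ (B * heat_envelope b (3 / 8) s d t)).
    rewrite ler_wpM2r ?heat_envelope_ge0// -[leRHS]invrK lef_pV2 ?posrE
      ?addr_gt0 ?invr_gt0//.
    by rewrite lerDr ltW.
  rewrite /B /N /heat_envelope.
  have -> : 3 / 8 * d ^+ 2 / t = w + w + w by rewrite /w; field; rewrite gt_eqF.
  have -> : expR (- (w + w + w)) = expR (- (w + w)) * expR (- w).
    by rewrite -expRD; congr expR; ring.
  set e2 := expR (- (w + w)).
  have -> : 2 `^ (- (1 / 2)) * C^-1 * K^-1 * (t `^ (- (1 / 2)) *
      (t + s ^+ 2) `^ (- b) * (e2 * expR (- w))) =
    2 `^ (- (1 / 2)) * C^-1 * t `^ (- (1 / 2)) * e2 *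
      (K^-1 * expR (- w) * (t + s ^+ 2) `^ (- b)) by ring.
  have -> : C^-1 * (2 `^ (- (1 / 2)) * (t `^ (- (1 / 2)) * Z `^ (- b) * e2)) =
    2 `^ (- (1 / 2)) * C^-1 * t `^ (- (1 / 2)) * e2 * Z `^ (- b) by ring.
  apply: ler_wpM2l; first by rewrite !mulr_ge0 ?powR_ge0 ?expR_ge0 ?invr_ge0
    ?(ltW C0).
  by rewrite expRN -invfM ler_pdivrMl// mulr_gt0 ?expR_gt0.
apply: (le_trans W1).
apply: (@le_trans _ _ (A * heat_envelope b (1 / 8) s d t)); last first.
  by rewrite ler_wpM2r ?heat_envelope_ge0// lerDl invr_ge0 ltW.
rewrite /A /N /heat_envelope.
have -> : 1 / 8 * d ^+ 2 / t = w by rewrite /w; field; rewrite gt_eqF.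
have -> : expR (- (w + w)) = expR (- w) * expR (- w).
  by rewrite -expRD; congr expR; ring.
set e1 := expR (- w).
have -> : C * (2 `^ (- (1 / 2)) * (t `^ (- (1 / 2)) * Z `^ (- b) * (e1 * e1))) =
  2 `^ (- (1 / 2)) * C * t `^ (- (1 / 2)) * e1 * (e1 * Z `^ (- b)) by ring.
have -> : 2 `^ (- (1 / 2)) * C * K * (t `^ (- (1 / 2)) * (t + s ^+ 2) `^ (- b)
  * e1) =
  2 `^ (- (1 / 2)) * C * t `^ (- (1 / 2)) * e1 * (K * (t + s ^+ 2) `^ (- b)) by
    ring.
apply: ler_wpM2l; first by rewrite !mulr_ge0 ?powR_ge0 ?expR_ge0 ?(ltW C0).
by rewrite /e1 expRN ler_pdivrMl ?expR_gt0// mulrCA mulrA.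
Qed.
End BesselBounds.

(** * Lower bounds for the envelope potential *)
Section KernelLower.
Context {R : realType}.
Notation mu := (@lebesgue_measure R).
Implicit Types (p b c s d t x y : R).

Lemma powR_factor_ge K p x y : 0 < y -> 1 <= K -> y <= x -> x <= K * y ->
  (K `^ `|p|)^-1 * y `^ p <= x `^ p.
Proof.
move=> y0 K1 yx xK; have x0 : 0 < x by lra.
rewrite ler_pdivrMl ?powR_gt0//; last lra.
by apply: powR_comparable => //; nra.
Qed.

Lemma powR_factor_le K p x y : 0 < y -> 1 <= K -> y <= x -> x <= K * y ->
  x `^ p <= K `^ `|p| * y `^ p.
Proof. by move=> y0 K1 yx xK; apply: powR_comparable => //; nra. Qed.

(** Here [p] stands for sigma - 3/2. *)
Definition envelope_integrand p b c s d t : R :=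
  expR (- t) * t `^ p * (t + s ^+ 2) `^ (- b) * expR (- (c * d ^+ 2 / t)).

Lemma envelope_integrand_ge0 p b c s d t : 0 <= envelope_integrand p b c s d t.
Proof. by rewrite !mulr_ge0 ?powR_ge0 ?expR_ge0. Qed.

Definition envelope_potential p b c s d : \bar R :=
  (\int[mu]_(t in `]0%R, +oo[) (envelope_integrand p b c s d t)%:E)%E.

Lemma expR_frac_ge (M c d t : R) : 0 < t -> 0 <= c -> d ^+ 2 <= M * t ->
  expR (- (c * M)) <= expR (- (c * d ^+ 2 / t)).
Proof.
move=> t0 c0 dt; rewrite ler_expR lerN2 ler_pdivrMr// -mulrA.
exact: ler_wpM2l.
Qed.

(** The times from e^2 / 2 to e^2, where t + s^2 is comparable to s^2 and both
    exponentials are bounded below. The scale [e] is left free: the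
    singularity in [d] is seen at [e = d], the behaviour in [s] at [e = s],
    and the divergence on the diagonal as [e] tends to 0. *)
Lemma envelope_potential_ge_block p b c : 0 <= c -> exists k, 0 < k /\
  forall s d e, 0 < e -> e <= 1 -> e <= s -> 0 <= d -> d <= e ->
  ((k * ((s ^+ 2) `^ (- b) * (e ^+ 2) `^ (p + 1)))%:E
     <= envelope_potential p b c s d)%E.
Proof.
move=> c0.
exists (expR (- 1) * (2 `^ `|p|)^-1 * (2 `^ `|- b|)^-1 * expR (- (c * 2)) / 2).
have h2 q : 0 < (2 `^ q)^-1 :> R by rewrite invr_gt0 powR_gt0.
split; first by rewrite !mulr_gt0 ?expR_gt0 ?invr_gt0.
move=> s d e e0 e1 es d0 de.
have e20 : 0 < e ^+ 2 by rewrite exprn_gt0.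
have e21 : e ^+ 2 <= 1 by rewrite expr_le1// ltW.
have es2 : e ^+ 2 <= s ^+ 2 by rewrite ler_sqr ?nnegrE//; lra.
have de2 : d ^+ 2 <= e ^+ 2 by rewrite ler_sqr ?nnegrE//; lra.
rewrite powRD_gt0// powRr1 ?(ltW e20)//.
set X := expR (-1) * _ * _ * _.
have -> : X / 2 * ((s ^+ 2) `^ (- b) * ((e ^+ 2) `^ p * e ^+ 2)) =
   X * ((s ^+ 2) `^ (- b) * (e ^+ 2) `^ p) * (e ^+ 2 - e ^+ 2 / 2) by field.
apply: ge0_integral_ge_cst.
- lra.
- by rewrite !mulr_ge0 ?expR_ge0 ?powR_ge0// ?invr_ge0 ?powR_ge0.
- by move=> t /=; rewrite !in_itv/= andbT; lra.
- by move=> t _; exact: envelope_integrand_ge0.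
move=> t /andP[t1 t2]; have t0 : 0 < t by lra.
have -> : X * ((s ^+ 2) `^ (- b) * (e ^+ 2) `^ p) =
  expR (- 1) * ((2 `^ `|p|)^-1 * (e ^+ 2) `^ p) *
  ((2 `^ `|- b|)^-1 * (s ^+ 2) `^ (- b)) * expR (- (c * 2)) by rewrite /X; ring.
have q1 : 0 <= (2 `^ `|p|)^-1 * (e ^+ 2) `^ p by rewrite mulr_ge0 ?powR_ge0
  ?(ltW (h2 _)).
have q2 : 0 <= (2 `^ `|- b|)^-1 * (s ^+ 2) `^ (- b) by rewrite mulr_ge0
  ?powR_ge0 ?(ltW (h2 _)).
rewrite /envelope_integrand; apply: ler_pM;
  rewrite ?mulr_ge0 ?expR_ge0 ?powR_ge0 ?(ltW (h2 _))//; last first.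
  by apply: expR_frac_ge => //; lra.
apply: ler_pM; rewrite ?mulr_ge0 ?expR_ge0 ?powR_ge0 ?(ltW (h2 _))//;
  last first.
  by apply: powR_factor_ge; lra.
apply: ler_pM; rewrite ?expR_ge0//; first by rewrite ler_expR; lra.
rewrite ler_pdivrMl ?powR_gt0//.
by apply: powR_comparable => //; lra.
Qed.

(** For p = -1 the integrand is at least a multiple of s^(-2b) / t from e^2 to
    m^2. *)
Lemma envelope_potential_ge_ln_diag b c : 0 <= c -> exists k, 0 < k /\
  forall s d e m, 0 < e -> e <= m -> m <= 1 -> m <= s -> 0 <= d -> d <= e ->
  ((k * ((s ^+ 2) `^ (- b) * ln (m / e)))%:E
     <= envelope_potential (- 1) b c s d)%E.
Proof.
move=> c0.
exists (expR (- 1) * (2 `^ `|- b|)^-1 * expR (- (c * 1))).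
have h2 q : 0 < (2 `^ q)^-1 :> R by rewrite invr_gt0 powR_gt0.
split; first by rewrite !mulr_gt0 ?expR_gt0 ?invr_gt0.
move=> s d e m e0 em m1 ms d0 de; have m0 : 0 < m by lra.
have e20 : 0 < e ^+ 2 by rewrite exprn_gt0.
have m21 : m ^+ 2 <= 1 by rewrite expr_le1// ltW.
have em2 : e ^+ 2 <= m ^+ 2 by rewrite ler_sqr ?nnegrE//; lra.
have ms2 : m ^+ 2 <= s ^+ 2 by rewrite ler_sqr ?nnegrE//; lra.
have de2 : d ^+ 2 <= e ^+ 2 by rewrite ler_sqr ?nnegrE//; lra.
set X := expR (-1) * _ * _; set Y := (s ^+ 2) `^ (- b).
have X0 : 0 < X by rewrite !mulr_gt0 ?expR_gt0.
have Y0 : 0 <= Y by exact: powR_ge0.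
have lnme : ln (m ^+ 2 / e ^+ 2) = ln (m / e) * 2.
  by rewrite -expr_div_n lnXn ?divr_gt0// mulr_natr.
have -> : X * (Y * ln (m / e)) = X * Y / 2 * ln (m ^+ 2 / e ^+ 2).
  by rewrite lnme; field.
apply: ge0_integral_ge_inv => //.
- by rewrite divr_ge0// mulr_ge0// ltW.
- by move=> t /=; rewrite !in_itv/= andbT; lra.
- by move=> t _; exact: envelope_integrand_ge0.
move=> t /andP[t1 t2]; have t0 : 0 < t by lra.
apply: (@le_trans _ _ (X * Y * t `^ (- 1))).
  rewrite ler_wpM2r ?powR_ge0// ler_piMr ?mulr_ge0 ?(ltW X0)//; lra.
have -> : X * Y * t `^ (- 1) = expR (- 1) * t `^ (- 1) *
  ((2 `^ `|- b|)^-1 * (s ^+ 2) `^ (- b)) * expR (- (c * 1)) by rewrite /X /Y;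
    ring.
have q2 : 0 <= (2 `^ `|- b|)^-1 * (s ^+ 2) `^ (- b) by rewrite mulr_ge0
  ?powR_ge0// ltW.
rewrite /envelope_integrand; apply: ler_pM;
  rewrite ?mulr_ge0 ?expR_ge0 ?powR_ge0// ?(ltW (h2 _))//; last first.
  by apply: expR_frac_ge => //; lra.
apply: ler_pM; rewrite ?mulr_ge0 ?expR_ge0 ?powR_ge0// ?(ltW (h2 _))//;
  last first.
  by apply: powR_factor_ge; lra.
by rewrite ler_wpM2r ?powR_ge0// ler_expR; lra.
Qed.

(** The times from 1 to 2 suffice. *)
Lemma envelope_potential_ge_cst p b c : 0 <= c -> exists k, 0 < k /\
  forall s d, 0 < s -> s <= 1 -> 0 <= d -> d <= s ->
    (k%:E <= envelope_potential p b c s d)%E.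
Proof.
move=> c0.
exists (expR (- 2) * (2 `^ `|p|)^-1 * (3 `^ `|- b|)^-1 * expR (- (c * 1))).
have h2 q : 0 < (2 `^ q)^-1 :> R by rewrite invr_gt0 powR_gt0.
have h3 q : 0 < (3 `^ q)^-1 :> R by rewrite invr_gt0 powR_gt0.
set X := expR (-2) * _ * _ * _.
have X0 : 0 < X by rewrite !mulr_gt0 ?expR_gt0.
split => // s d s0 s1 d0 ds.
have s21 : s ^+ 2 <= 1 by rewrite expr_le1// ltW.
have ds2 : d ^+ 2 <= s ^+ 2 by rewrite ler_sqr ?nnegrE//; lra.
have s20 : 0 <= s ^+ 2 by exact: sqr_ge0.
have -> : X = X * (2 - 1) by ring.
apply: ge0_integral_ge_cst.
- lra.
- exact: ltW.
- by move=> t /=; rewrite !in_itv/= andbT; lra.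
- by move=> t _; exact: envelope_integrand_ge0.
move=> t /andP[t1 t2]; have t0 : 0 < t by lra.
rewrite /envelope_integrand /X; apply: ler_pM;
  rewrite ?mulr_ge0 ?expR_ge0 ?powR_ge0// ?(ltW (h2 _)) ?(ltW (h3 _))//;
  last first.
  by apply: expR_frac_ge => //; lra.
apply: ler_pM; rewrite ?mulr_ge0 ?expR_ge0 ?powR_ge0// ?(ltW (h2 _)) ?(ltW (h3
  _))//; last first.
  have := @powR_factor_ge 3 (- b) (t + s ^+ 2) 1; rewrite powR1 !mulr1; apply;
    lra.
apply: ler_pM; rewrite ?expR_ge0 ?(ltW (h2 _))//; first by rewrite ler_expR;
  lra.
have := @powR_factor_ge 2 p t 1; rewrite powR1 !mulr1; apply; lra.
Qed.

(** From s^2 to 1 the number t + s^2 is comparable to t, and for p = b - 1 the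
    two powers combine to 1 / t. *)
Lemma envelope_potential_ge_ln_origin b c : 0 <= c -> exists k, 0 < k /\
  forall s d, 0 < s -> s <= 1 -> 0 <= d -> d <= s ->
  ((k * ln (1 / s))%:E <= envelope_potential (b - 1) b c s d)%E.
Proof.
move=> c0.
exists (expR (- 1) * (2 `^ `|- b|)^-1 * expR (- (c * 1))).
have h2 q : 0 < (2 `^ q)^-1 :> R by rewrite invr_gt0 powR_gt0.
set X := expR (-1) * _ * _.
have X0 : 0 < X by rewrite !mulr_gt0 ?expR_gt0.
split => // s d s0 s1 d0 ds.
have s20 : 0 < s ^+ 2 by rewrite exprn_gt0.
have s21 : s ^+ 2 <= 1 by rewrite expr_le1// ltW.
have ds2 : d ^+ 2 <= s ^+ 2 by rewrite ler_sqr ?nnegrE//; lra.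
have lns : ln (1 / s ^+ 2) = ln (1 / s) * 2.
  by rewrite -{1}(expr1n R 2) -expr_div_n lnXn ?divr_gt0// mulr_natr.
have -> : X * ln (1 / s) = X / 2 * ln (1 / s ^+ 2) by rewrite lns; field.
apply: ge0_integral_ge_inv => //.
- by rewrite divr_ge0// ltW.
- by move=> t /=; rewrite !in_itv/= andbT; lra.
- by move=> t _; exact: envelope_integrand_ge0.
move=> t /andP[t1 t2]; have t0 : 0 < t by lra.
apply: (@le_trans _ _ (X * t `^ (- 1))).
  rewrite ler_wpM2r ?powR_ge0// ler_piMr ?(ltW X0)//; lra.
have -> : X * t `^ (- 1) = expR (- 1) * t `^ (b - 1) *
  ((2 `^ `|- b|)^-1 * t `^ (- b)) * expR (- (c * 1)).
  have e1 : t `^ (- 1) = t `^ (b - 1) * t `^ (- b).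
    by rewrite -powRD_gt0//; congr (_ `^ _); ring.
  by rewrite /X e1; ring.
rewrite /envelope_integrand; apply: ler_pM;
  rewrite ?mulr_ge0 ?expR_ge0 ?powR_ge0// ?(ltW (h2 _))//; last first.
  by apply: expR_frac_ge => //; lra.
apply: ler_pM; rewrite ?mulr_ge0 ?expR_ge0 ?powR_ge0// ?(ltW (h2 _))//;
  last first.
  by apply: powR_factor_ge; lra.
by rewrite ler_wpM2r ?powR_ge0// ler_expR; lra.
Qed.

(** The exponent t + c d^2 / t is smallest at a time of order d. A window of
    length one at t = 1 + d keeps away from t = 0, and the powers of d lost
    there are absorbed in an exponential of d. *)
Lemma envelope_potential_ge_far p b c : 0 <= c -> exists k, 0 < k /\
  forall s d, 1 <= s -> 0 <= d ->
  ((k * ((s ^+ 2) `^ (- b) * expR (- ((c + 2) * d))))%:E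
     <= envelope_potential p b c s d)%E.
Proof.
move=> c0.
have [C [C0 HC]] := powR_le_expR (`|p| + `|- b|) 1 (addr_ge0 (normr_ge0 _)
  (normr_ge0 _)) ltr01.
exists (expR (- 2) * (C * expR 3)^-1).
set X := expR (-2) * _.
have X0 : 0 < X by rewrite !mulr_gt0 ?expR_gt0 ?invr_gt0 ?mulr_gt0 ?expR_gt0.
split => // s d s1 d0.
have s21 : 1 <= s ^+ 2 by rewrite expr_ge1//; lra.
have -> : X * ((s ^+ 2) `^ (- b) * expR (- ((c + 2) * d))) =
  X * ((s ^+ 2) `^ (- b) * expR (- ((c + 2) * d))) * ((2 + d) - (1 + d)) by
    ring.
apply: ge0_integral_ge_cst.
- lra.
- by rewrite (mulr_ge0 (ltW X0))// mulr_ge0 ?powR_ge0 ?expR_ge0.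
- by move=> t /=; rewrite !in_itv/= andbT; lra.
- by move=> t _; exact: envelope_integrand_ge0.
move=> t /andP[t1 t2]; have t0 : 0 < t by lra.
have d30 : 0 < 3 + d by lra.
have q1 : ((3 + d) `^ `|p|)^-1 <= t `^ p.
  have := @powR_factor_ge (3 + d) p t 1; rewrite powR1 !mulr1; apply; lra.
have q2 : ((3 + d) `^ `|- b|)^-1 * (s ^+ 2) `^ (- b) <= (t + s ^+ 2) `^ (- b).
  by apply: powR_factor_ge; nra.
have q3 : (C * expR 3)^-1 * expR (- d) <= ((3 + d) `^ `|p|)^-1 * ((3 + d) `^
  `|- b|)^-1.
  rewrite expRN -!invfM lef_pV2 ?posrE ?mulr_gt0 ?expR_gt0 ?powR_gt0//.
  rewrite -powRD_gt0//; apply: (le_trans (HC _ d30)).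
  by rewrite -mulrA -expRD ler_wpM2l ?(ltW C0)// ler_expR; lra.
have q4 : expR (- (c * d)) <= expR (- (c * d ^+ 2 / t)).
  by apply: expR_frac_ge => //; nra.
have q5 : expR (- 2) * expR (- d) <= expR (- t) by rewrite -expRD ler_expR; lra.
have -> : expR (- ((c + 2) * d)) = expR (- d) * expR (- d) * expR (- (c * d)).
  by rewrite -!expRD; congr expR; ring.
have h3 q : 0 <= ((3 + d) `^ q)^-1 by rewrite invr_ge0 powR_ge0.
apply: (@le_trans _ _ (expR (- 2) * expR (- d) * ((3 + d) `^ `|p|)^-1 *
  (((3 + d) `^ `|- b|)^-1 * (s ^+ 2) `^ (- b)) * expR (- (c * d)))).
  rewrite /X.
  have -> : expR (-2) / (C * expR 3) * ((s ^+ 2) `^ (- b) * (expR (- d) * expR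
    (- d) * expR (- (c * d)))) =
    expR (-2) * expR (- d) * (s ^+ 2) `^ (- b) * expR (- (c * d)) * ((C * expR
      3)^-1 * expR (- d)) by ring.
  have -> : expR (- 2) * expR (- d) * ((3 + d) `^ `|p|)^-1 *
  (((3 + d) `^ `|- b|)^-1 * (s ^+ 2) `^ (- b)) * expR (- (c * d)) =
    expR (-2) * expR (- d) * (s ^+ 2) `^ (- b) * expR (- (c * d)) * (((3 + d)
      `^ `|p|)^-1 * ((3 + d) `^ `|- b|)^-1) by ring.
  by rewrite ler_wpM2l// !mulr_ge0 ?expR_ge0 ?powR_ge0.
by rewrite /envelope_integrand; do 3 (apply: ler_pM;
  rewrite ?mulr_ge0 ?expR_ge0 ?powR_ge0//).
Qed.
End KernelLower.

(** * Upper bounds for the envelope potential *)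
Section KernelUpper.
Context {R : realType}.
Notation mu := (@lebesgue_measure R).
Implicit Types (p b c s d t m : R).

Definition near_integrand p c d t : R := t `^ p * expR (- (c * d ^+ 2 / t)).

Lemma near_integrand_ge0 p c d t : 0 <= near_integrand p c d t.
Proof. by rewrite mulr_ge0 ?powR_ge0 ?expR_ge0. Qed.

Lemma measurable_inv : measurable_fun setT (@GRing.inv R).
Proof.
have -> : @GRing.inv R = (fun t : R => t * (t ^+ 2) `^ (- 1)).
  apply/funext => t; rewrite powR_inv1 ?sqr_ge0//.
  have [->|t0] := eqVneq t 0; first by rewrite mul0r invr0.
  by field.
apply: measurable_funM => //.
apply: (@measurableT_comp _ _ _ _ _ _ (@powR R ^~ (- 1))) => //.
Qed.

Lemma measurable_near_integrand p c d :
  measurable_fun setT (near_integrand p c d).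
Proof.
apply: measurable_funM; first exact: measurable_powR.
apply: measurableT_comp => //; apply: measurable_funN.
by apply: measurable_funM => //; exact: measurable_inv.
Qed.

(** The size of the integral of [near_integrand p c d] up to [m ^+ 2]. The
    cases of [p] are those of sigma < 1/2, sigma = 1/2 and sigma > 1/2. *)
Definition near_profile p m d : R :=
  if p < -1 then (d ^+ 2) `^ (p + 1)
  else if p == -1 then 1 + Num.max (ln (m / d)) 0
  else (m ^+ 2) `^ (p + 1).

Lemma near_integrand_le_powR p c d t : 0 <= c -> 0 < t ->
  near_integrand p c d t <= t `^ p.
Proof.
move=> c0 t0; rewrite ler_piMr ?powR_ge0// expR_le1 oppr_le0.
by rewrite mulr_ge0 ?invr_ge0 ?(ltW t0)// mulr_ge0 ?sqr_ge0.
Qed.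

(** With u = d^2 / t the integrand is (d^2)^p u^(-p) e^(- c u): for p <= 0 the
    exponential compensates the singularity at t = 0. *)
Lemma near_integrand_le_cst p c : p <= 0 -> 0 < c -> exists C, 0 < C /\
  forall d t, 0 < d -> 0 < t -> near_integrand p c d t <= C * (d ^+ 2) `^ p.
Proof.
move=> p0 c0; have [C [C0 HC]] := powR_le_expR (- p) c ltac:(lra) c0.
exists C; split => // d t d0 t0.
have d20 : 0 < d ^+ 2 by rewrite exprn_gt0.
have u0 : 0 < d ^+ 2 / t by rewrite divr_gt0.
have tE : t `^ p = (d ^+ 2) `^ p * (d ^+ 2 / t) `^ (- p).
  rewrite powRM ?invr_ge0 ?(ltW t0) ?(ltW d20)// mulrA -powRD_gt0// subrr
    powRr0 mul1r.
  by rewrite -(powR_inv1 (ltW t0)) -powRrM mulN1r opprK.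
rewrite /near_integrand tE (mulrC C) -mulrA ler_wpM2l ?powR_ge0//.
rewrite expRN ler_pdivrMr ?expR_gt0// -mulrA.
exact: HC.
Qed.

(** Below t = d^2 the integrand is at most a multiple of (d^2)^p, and above it
    is at most t^p. *)
Lemma integral_near_integrand_le p c : 0 < c -> exists K, 0 < K /\
  forall m d, 0 < m -> 0 <= d -> (p <= -1 -> 0 < d) ->
  (\int[mu]_(t in `]0%R, (m ^+ 2)%R]) (near_integrand p c d t)%:E
     <= (K * near_profile p m d)%:E)%E.
Proof.
move=> c0.
have near0 (C a d : R) : 0 < C -> 0 < d -> 0 < a ->
    (forall t, 0 < t -> near_integrand p c d t <= C * (d ^+ 2) `^ p) ->
    (\int[mu]_(t in `]0%R, a]) (near_integrand p c d t)%:E <= (C * (d ^+ 2) `^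
      p * a)%:E)%E.
  move=> C0 d0 a0 HC.
  apply: (@le_trans _ _ (\int[mu]_(t in `]0%R, a]) (C * (d ^+ 2) `^ p)%:E)%E).
    apply: (ge0_le_integral_subset _ _ _ (fun=> C * (d ^+ 2) `^ p)) => //.
    - by move=> t _; rewrite mulr_ge0 ?powR_ge0// ltW.
    - by move=> t _; exact: near_integrand_ge0.
    - by move=> t /=; rewrite in_itv/= => /andP[+ _]; exact: HC.
  by rewrite integral_cst//= lebesgue_measure_itv/= lte_fin a0 -EFinB subr0
    -EFinM.
have [p1|p1|p1] := ltgtP p (-1).
- have [C [C0 HC]] := near_integrand_le_cst p c ltac:(lra) c0.
  exists (C + (- p - 1)^-1); split; first by rewrite addr_gt0// invr_gt0; lra.
  move=> m d m0 _ /(_ isT) d0.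
  rewrite /near_profile p1.
  have d20 : 0 < d ^+ 2 by rewrite exprn_gt0.
  apply: (@le_trans _ _ (\int[mu]_(t in `]0%R,
    +oo[) (near_integrand p c d t)%:E)%E).
    apply: ge0_le_integral_subset => //; try by move=> t _;
      exact: near_integrand_ge0.
    by move=> t /=; rewrite !in_itv/= andbT => /andP[].
  rewrite (ge0_integral_split (near_integrand p c d) (d ^+ 2)) ?bnd_simp ?(ltW
    d20)//; last 2 first.
  - exact: measurable_near_integrand.
  - exact: near_integrand_ge0.
  rewrite mulrDl EFinD; apply: leeD.
    rewrite powRD_gt0// powRr1 ?(ltW d20)// mulrA.
    by apply: near0 => // t t0; exact: HC.
  apply: (@le_trans _ _ (\int[mu]_(t in `](d ^+ 2)%R, +oo[) (t `^ p)%:E)%E).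
    apply: ge0_le_integral_subset => //; try by move=> t _;
      rewrite ?near_integrand_ge0 ?powR_ge0.
    move=> t /=; rewrite in_itv/= andbT => dt; apply: near_integrand_le_powR;
      first exact: ltW.
    by lra.
  by rewrite mulrC; exact: integral_powR_y.
- exists (p + 1)^-1; split; first by rewrite invr_gt0; lra.
  move=> m d m0 d0 _; rewrite /near_profile ltNge (ltW p1)/= gt_eqF//.
  have m20 : 0 < m ^+ 2 by rewrite exprn_gt0.
  apply: (@le_trans _ _ (\int[mu]_(t in `]0%R, (m ^+ 2)%R]) (t `^ p)%:E)%E).
    apply: ge0_le_integral_subset => //; try by move=> t _;
      rewrite ?near_integrand_ge0 ?powR_ge0.
    by move=> t /=; rewrite in_itv/= => /andP[t0 _];
      apply: near_integrand_le_powR => //; exact: ltW.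
  by rewrite mulrC; exact: integral_powR_0.
- have [C [C0 HC]] := near_integrand_le_cst p c ltac:(lra) c0.
  exists (C + 2); split; first by lra.
  move=> m d m0 _ /(_ isT) d0; rewrite /near_profile p1 ltxx eqxx.
  have d20 : 0 < d ^+ 2 by rewrite exprn_gt0.
  have m20 : 0 < m ^+ 2 by rewrite exprn_gt0.
  rewrite p1 in HC near0.
  have [md|dm] := leP m d.
    apply: (@le_trans _ _ C%:E); last first.
      have : 0 <= Num.max (ln (m / d)) 0 by rewrite le_max lexx orbT.
      rewrite lee_fin; nra.
    apply: (le_trans (near0 C _ _ C0 d0 m20 (fun t => HC d t d0))).
    rewrite lee_fin powR_inv1 ?(ltW d20)// -mulrA ler_piMr ?(ltW C0)//.
    by rewrite ler_pdivrMl// mulr1 ler_sqr ?nnegrE//; lra.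
  have dm2 : d ^+ 2 <= m ^+ 2 by rewrite ler_sqr ?nnegrE//; lra.
  rewrite (ge0_integral_split (near_integrand (-1) c d) (d ^+ 2)) ?bnd_simp
    ?(ltW d20)//; last 2 first.
  - exact: measurable_near_integrand.
  - exact: near_integrand_ge0.
  have l0 : 0 <= ln (m / d) by rewrite ln_ge0// ler_pdivlMr// mul1r ltW.
  apply: (@le_trans _ _ (C%:E + (2 * ln (m / d))%:E)%E); last first.
    rewrite -EFinD lee_fin max_l//.
    by have := mulr_ge0 (ltW C0) l0; nra.
  apply: leeD.
    apply: (le_trans (near0 C _ _ C0 d0 d20 (fun t => HC d t d0))).
    by rewrite lee_fin powR_inv1 ?(ltW d20)// divfK ?gt_eqF.
  apply: (@le_trans _ _ (\int[mu]_(t in `](d ^+ 2)%R,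
    (m ^+ 2)%R]) (t `^ (-1))%:E)%E).
    apply: ge0_le_integral_subset => //; try by move=> t _;
      rewrite ?near_integrand_ge0 ?powR_ge0.
    move=> t /=; rewrite in_itv/= => /andP[dt _];
      apply: near_integrand_le_powR; first exact: ltW.
    by lra.
  rewrite integral_inv_oc// -expr_div_n lnXn ?divr_gt0//.
  by rewrite mulr_natl.
Qed.

Lemma measurable_envelope_integrand p b c s d :
  measurable_fun setT (envelope_integrand p b c s d).
Proof.
apply: measurable_funM; last first.
  apply: measurableT_comp => //; apply: measurable_funN.
  by apply: measurable_funM => //; exact: measurable_inv.
apply: measurable_funM; first exact: measurable_gamma_integrand.
apply: (@measurableT_comp _ _ _ _ _ _ (@powR R ^~ (- b))) => //.
exact: measurable_funD.
Qed.

(** The size of the integral of t^r from s^2 to 1, made at least 1 so that it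
    also covers the times beyond 1. *)
Definition middle_profile r s : R :=
  if -1 < r then 1 else if r == -1 then 1 + ln (1 / s) else (s ^+ 2) `^ (r + 1).

Lemma integral_powR_to1 r : exists K, 0 < K /\ forall s, 0 < s -> s <= 1 ->
  (\int[mu]_(t in `](s ^+ 2)%R, 1%R]) (t `^ r)%:E
     <= (K * middle_profile r s)%:E)%E.
Proof.
have sub01 s : 0 < s -> `](s ^+ 2)%R, 1%R]%classic `<=` `]0%R, 1%R]%classic.
  by move=> s0 t /=; rewrite !in_itv/= => /andP[st ->];
    rewrite andbT (lt_trans _ st)// exprn_gt0.
have suby s : `](s ^+ 2)%R, 1%R]%classic `<=` `](s ^+ 2)%R, +oo[%classic.
  by move=> t /=; rewrite !in_itv/= => /andP[->].
rewrite /middle_profile; have [r1|r1|r1] := ltgtP (-1) r.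
- exists (r + 1)^-1; split; first by rewrite invr_gt0; lra.
  move=> s s0 s1; rewrite mulr1.
  apply: (@le_trans _ _ (\int[mu]_(t in `]0%R, 1%R]) (t `^ r)%:E)%E).
    by apply: ge0_le_integral_subset; [exact: sub01|..] => // t _;
      exact: powR_ge0.
  apply: (le_trans (integral_powR_0 _ _ r1 ltr01)).
  by rewrite powR1 lee_fin div1r.
- exists (- r - 1)^-1; split; first by rewrite invr_gt0; lra.
  move=> s s0 s1; rewrite mulrC.
  apply: (@le_trans _ _ (\int[mu]_(t in `](s ^+ 2)%R, +oo[) (t `^ r)%:E)%E).
    by apply: ge0_le_integral_subset; [exact: suby|..] => // t _;
      exact: powR_ge0.
  by apply: integral_powR_y => //; rewrite exprn_gt0.
- exists 2; split => // s s0 s1; rewrite -r1.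
  rewrite integral_inv_oc ?exprn_gt0//; last by rewrite expr_le1// ltW.
  have -> : 1 / s ^+ 2 = (1 / s) ^+ 2 by rewrite expr_div_n expr1n.
  rewrite lnXn ?divr_gt0// lee_fin -[ln _ *+ 2]mulr_natl.
  by rewrite ler_wpM2l// lerDr.
Qed.

(** The cuts are at s^2 and 1: the number t + s^2 is comparable to s^2 before
    s^2 and to t afterwards. *)
Lemma envelope_potential_le_near p b c : 0 < c -> exists K, 0 < K /\
  forall s d, 0 < s -> s <= 1 -> 0 <= d -> (p <= -1 -> 0 < d) ->
  (envelope_potential p b c s d
     <= (K * ((s ^+ 2) `^ (- b) * near_profile p s d + middle_profile (p - b)
       s))%:E)%E.
Proof.
move=> c0.
have [K1 [K10 HK1]] := integral_near_integrand_le p c c0.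
have [K2 [K20 HK2]] := integral_powR_to1 (p - b).
have [K3 [K30 HK3]] := integral_expR_powR_y 1 (p - b) ltr01.
pose A := 2 `^ `|- b| : R; have A0 : 0 < A by rewrite powR_gt0.
exists (A * K1 + (A * K2 + A * K3)); split;
  first by rewrite !addr_gt0 ?mulr_gt0.
move=> s d s0 s1 d0 pd.
have s20 : 0 < s ^+ 2 by rewrite exprn_gt0.
have s21 : s ^+ 2 <= 1 by rewrite expr_le1// ltW.
have phi0 : 0 <= near_profile p s d.
  rewrite /near_profile; case: ifP => _; first exact: powR_ge0.
  by case: ifP => _; [rewrite addr_ge0// le_max lexx orbT|exact: powR_ge0].
have psi1 : 1 <= middle_profile (p - b) s.
  rewrite /middle_profile; case: ltP => // r1; case: eqP => [_|_].
    by rewrite lerDl ln_ge0// ler_pdivlMr// mul1r.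
  have := @powR_ge_base R (p - b + 1) (s ^+ 2) 1; rewrite powR1; apply => //;
    lra.
rewrite /envelope_potential (ge0_integral_split (envelope_integrand p b c s d)
  (s ^+ 2)) ?bnd_simp ?(ltW s20)//; last 2 first.
- exact: measurable_envelope_integrand.
- exact: envelope_integrand_ge0.
rewrite (ge0_integral_split (envelope_integrand p b c s d) 1 (BRight (s ^+ 2)))
  ?bnd_simp//; last 2 first.
- exact: measurable_envelope_integrand.
- exact: envelope_integrand_ge0.
have E1 (t : R) : 0 < t -> expR (- (c * d ^+ 2 / t)) <= 1.
  move=> t0; rewrite expR_le1 oppr_le0 mulr_ge0 ?invr_ge0 ?(ltW t0)//.
  by rewrite mulr_ge0 ?sqr_ge0// ltW.
set Y := (s ^+ 2) `^ (- b).
have Y0 : 0 <= Y by exact: powR_ge0.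
apply: (@le_trans _ _ ((A * Y * (K1 * near_profile p s d))%:E + ((A * (K2 *
  middle_profile (p - b) s))%:E + (A * K3)%:E))%E); last first.
  rewrite -!EFinD lee_fin.
  have h1 : 0 <= A * K1 * middle_profile (p - b) s by rewrite !mulr_ge0 ?ltW//;
    lra.
  have h2 : 0 <= (A * K2 + A * K3) * (Y * near_profile p s d).
    by rewrite mulr_ge0// ?mulr_ge0// addr_ge0// mulr_ge0// ltW.
  have h3 : A * K3 <= A * K3 * middle_profile (p - b) s by rewrite ler_peMr//
    mulr_ge0// ltW.
  have -> : (A * K1 + (A * K2 + A * K3)) * (Y * near_profile p s d +
    middle_profile (p - b) s) =
    A * Y * (K1 * near_profile p s d) + A * K1 * middle_profile (p - b) s
    + (A * K2 + A * K3) * (Y * near_profile p s d) + A * (K2 * middle_profile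
        (p - b) s) + A * K3 * middle_profile (p - b) s by ring.
  by lra.
apply: leeD; last apply: leeD.
- apply: (@ge0_integral_le_scale _ _ _ (near_integrand p c d)).
  + by rewrite mulr_ge0// ltW.
  + by [].
  + exact: measurable_near_integrand.
  + exact: near_integrand_ge0.
  + by move=> t _; exact: envelope_integrand_ge0.
  + move=> t /=; rewrite in_itv/= => /andP[t0 ts].
    rewrite /envelope_integrand /near_integrand.
    have -> : A * Y * (t `^ p * expR (- (c * d ^+ 2 / t))) =
       1 * t `^ p * (A * Y) * expR (- (c * d ^+ 2 / t)) by ring.
    rewrite ler_wpM2r ?expR_ge0//; apply: ler_pM;
      rewrite ?mulr_ge0 ?expR_ge0 ?powR_ge0//.
      by rewrite ler_wpM2r ?powR_ge0// expR_le1; lra.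
    by apply: powR_factor_le; lra.
  + exact: HK1.
- apply: (@ge0_integral_le_scale _ _ _ (@powR R ^~ (p - b))).
  + exact: ltW.
  + by [].
  + exact: measurable_powR.
  + by move=> t; exact: powR_ge0.
  + by move=> t _; exact: envelope_integrand_ge0.
  + move=> t /=; rewrite in_itv/= => /andP[ts t1]; have t0 : 0 < t by lra.
    rewrite /envelope_integrand powRD_gt0//.
    have -> : A * (t `^ p * t `^ (- b)) = 1 * t `^ p * (A * t `^ (- b)) * 1 by
      ring.
    apply: ler_pM; rewrite ?mulr_ge0 ?expR_ge0 ?powR_ge0 ?E1//.
    apply: ler_pM; rewrite ?mulr_ge0 ?expR_ge0 ?powR_ge0//.
      by rewrite ler_wpM2r ?powR_ge0// expR_le1; lra.
    by apply: powR_factor_le; lra.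
  + exact: HK2.
apply: (@ge0_integral_le_scale _ _ _ (fun t => expR (- t) * t `^ (p - b))).
- exact: ltW.
- by [].
- exact: measurable_gamma_integrand.
- by move=> t; rewrite mulr_ge0 ?expR_ge0 ?powR_ge0.
- by move=> t _; exact: envelope_integrand_ge0.
- move=> t /=; rewrite in_itv/= andbT => t1; have t0 : 0 < t by lra.
  rewrite /envelope_integrand powRD_gt0//.
  have -> : A * (expR (- t) * (t `^ p * t `^ (- b))) = expR (- t) * t `^ p * (A
    * t `^ (- b)) * 1 by ring.
  apply: ler_pM; rewrite ?mulr_ge0 ?expR_ge0 ?powR_ge0 ?E1//.
  apply: ler_pM; rewrite ?mulr_ge0 ?expR_ge0 ?powR_ge0//.
  by apply: powR_factor_le; lra.
- by move: HK3; under eq_integral do rewrite mul1r.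
Qed.

(** One half of t + c d^2 / t is at least k d, by the inequality of arithmetic
    and geometric means and k^2 <= c; the other half keeps the integral
    convergent. As s^2 <= t + s^2 <= (1 + t) s^2, the weight only costs a
    power of 1 + t. *)
Lemma envelope_potential_le_far p b c : 0 < c -> exists K k, [/\ 0 < K, 0 < k &
  forall s d, 1 <= s -> 0 <= d -> (p <= -1 -> 0 < d) ->
  (envelope_potential p b c s d <=
    (K * ((s ^+ 2) `^ (- b) * (near_profile p 1 d + 1) * expR (- (k *
      d))))%:E)%E].
Proof.
move=> c0; have c20 : 0 < c / 2 by lra.
(* a constant with k^2 <= c, as the square completed below requires *)
pose k := Num.min 1 c.
have k0 : 0 < k by rewrite lt_min ltr01.
have kc : k ^+ 2 <= c.
  have k1 : k <= 1 by rewrite ge_min lexx.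
  have : k <= c by rewrite ge_min lexx orbT.
  by apply: le_trans; rewrite expr2 ler_piMr// ltW.
have [K1 [K10 HK1]] := integral_near_integrand_le p (c / 2) c20.
have [K3 [K30 HK3]] := integral_expR_powR_y (1 / 4) p ltac:(lra).
have [C [C0 HC]] := powR_le_expR `|- b| (1 / 4) (normr_ge0 _) ltac:(lra).
pose A := C * expR (1 / 4); have A0 : 0 < A by rewrite mulr_gt0 ?expR_gt0.
exists (A * K1 + A * K3), k; split => //; first by rewrite !addr_gt0 ?mulr_gt0.
move=> s d s1 d0 pd.
have s21 : 1 <= s ^+ 2 by rewrite expr_ge1//; lra.
have phi0 : 0 <= near_profile p 1 d.
  rewrite /near_profile; case: ifP => _; first exact: powR_ge0.
  by case: ifP => _; [rewrite addr_ge0// le_max lexx orbT|exact: powR_ge0].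
rewrite /envelope_potential (ge0_integral_split (envelope_integrand p b c s d)
  1) ?bnd_simp//; last 2 first.
- exact: measurable_envelope_integrand.
- exact: envelope_integrand_ge0.
set Y := (s ^+ 2) `^ (- b).
have Y0 : 0 <= Y by exact: powR_ge0.
set X := expR (- (k * d)); have X0 : 0 <= X by exact: expR_ge0.
have gle (t : R) : 0 < t -> envelope_integrand p b c s d t <=
    A * Y * X * (expR (- (1 / 4 * t)) * near_integrand p (c / 2) d t).
  move=> t0; have t10 : 0 < 1 + t by lra.
  have q1 : (t + s ^+ 2) `^ (- b) <= A * expR (1 / 4 * t) * Y.
    apply: (@le_trans _ _ ((1 + t) `^ `|- b| * Y));
      first by apply: powR_factor_le; nra.
    rewrite ler_wpM2r//; apply: (le_trans (HC _ t10)).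
    by rewrite /A -mulrA -expRD ler_wpM2l ?(ltW C0)// ler_expR; lra.
  have q2 : expR (- t) * expR (- (c * d ^+ 2 / t)) <=
      X * (expR (- (1 / 2 * t)) * expR (- (c / 2 * d ^+ 2 / t))).
    rewrite /X -!expRD ler_expR -subr_ge0.
    have -> : - (k * d) + (- (1 / 2 * t) - c / 2 * d ^+ 2 / t) - (- t - c * d
      ^+ 2 / t)
      = ((t - k * d) ^+ 2 + (c - k ^+ 2) * d ^+ 2) / (2 * t) by field;
        rewrite gt_eqF.
    rewrite divr_ge0//; last lra.
    by rewrite addr_ge0 ?sqr_ge0// mulr_ge0 ?sqr_ge0//; lra.
  rewrite /envelope_integrand /near_integrand.
  have -> : expR (- t) * t `^ p * (t + s ^+ 2) `^ (- b) * expR (- (c * d ^+ 2 /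
    t)) =
    t `^ p * ((t + s ^+ 2) `^ (- b) * (expR (- t) * expR (- (c * d ^+ 2 / t))))
      by ring.
  apply: (@le_trans _ _ (t `^ p * (A * expR (1 / 4 * t) * Y *
      (X * (expR (- (1 / 2 * t)) * expR (- (c / 2 * d ^+ 2 / t))))))).
    by rewrite ler_wpM2l ?powR_ge0//; apply: ler_pM;
      rewrite ?mulr_ge0 ?expR_ge0 ?powR_ge0.
  have -> : expR (- (1 / 4 * t)) = expR (1 / 4 * t) * expR (- (1 / 2 * t)).
    by rewrite -expRD; congr expR; field.
  by rewrite le_eqVlt; apply/orP; left; apply/eqP; ring.
have AYX0 : 0 <= A * Y * X by rewrite !mulr_ge0// ltW.
apply: (@le_trans _ _ ((A * Y * X * (K1 * near_profile p 1 d))%:E + (A * Y * X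
  * K3)%:E)%E); last first.
  rewrite -EFinD lee_fin.
  have -> : (A * K1 + A * K3) * (Y * (near_profile p 1 d + 1) * X) =
    A * Y * X * (K1 * near_profile p 1 d) + A * Y * X * K3 + A * Y * X * (K1 +
      K3 * near_profile p 1 d) by ring.
  by rewrite lerDl mulr_ge0// addr_ge0 ?mulr_ge0// ltW.
apply: leeD.
- apply: (@ge0_integral_le_scale _ _ _ (near_integrand p (c / 2) d)).
  + by [].
  + by [].
  + exact: measurable_near_integrand.
  + exact: near_integrand_ge0.
  + by move=> t _; exact: envelope_integrand_ge0.
  + move=> t /=; rewrite in_itv/= => /andP[t0 _]; apply: (le_trans (gle t t0)).
    rewrite ler_wpM2l// ler_piMl ?near_integrand_ge0// expR_le1; lra.
  + by have := HK1 1 d ltr01 d0 pd; rewrite expr1n.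
apply: (@ge0_integral_le_scale _ _ _ (fun t => expR (- (1 / 4 * t)) * t `^ p)).
- by [].
- by [].
- apply: measurable_funM; last exact: measurable_powR.
  apply: measurableT_comp => //; apply: measurable_funN.
  exact: measurable_funM.
- by move=> t; rewrite mulr_ge0 ?expR_ge0 ?powR_ge0.
- by move=> t _; exact: envelope_integrand_ge0.
- move=> t /=; rewrite in_itv/= andbT => t1; have t0 : 0 < t by lra.
  apply: (le_trans (gle t t0)); rewrite ler_wpM2l// ler_wpM2l ?expR_ge0//.
  by apply: near_integrand_le_powR => //; exact: ltW.
- exact: HK3.
Qed.
End KernelUpper.

(** * Comparison with the closed formulas *)
Section Assembly.
Context {R : realType}.
Notation mu := (@lebesgue_measure R).
Implicit Types (alpha sigma b p c s d x y : R).

Lemma powR_sqr x q : 0 <= x -> (x ^+ 2) `^ q = x `^ (2 * q).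
Proof. by move=> x0; rewrite -powR_mulrn// -powRrM. Qed.

Lemma weightE alpha s : 0 <= s ->
  s `^ (- 2 * alpha - 1) = (s ^+ 2) `^ (- (alpha + 1 / 2)).
Proof. by move=> s0; rewrite powR_sqr//; congr (_ `^ _); field. Qed.

Lemma sqr_powE sigma x : 0 <= x ->
  (x ^+ 2) `^ (sigma - 3 / 2 + 1) = x `^ (2 * sigma - 1).
Proof. by move=> x0; rewrite powR_sqr//; congr (_ `^ _); field. Qed.

Lemma besselH_envelope alpha sigma : -1 < alpha -> 0 < sigma ->
  exists C, 0 < C /\ forall x y, 0 < x -> 0 < y ->
  ((C^-1)%:E * envelope_potential (sigma - 3 / 2)%R (alpha + 1 / 2)%R (3 / 8)%R
    (x + y)%R `|x - y|%R
     <= besselH alpha sigma x y)%E /\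
  (besselH alpha sigma x y <=
   C%:E * envelope_potential (sigma - 3 / 2)%R (alpha + 1 / 2)%R (1 / 8)%R (x +
     y)%R `|x - y|%R)%E.
Proof.
move=> a1 s0; have G0 := Gamma_gt0 sigma s0.
have [C [C0 HC]] := besselW_bounds alpha a1.
pose A := (Gamma sigma)^-1; have A0 : 0 < A by rewrite invr_gt0.
set p := sigma - 3 / 2; set b := alpha + 1 / 2.
have kE c s d t : 0 < t -> expR (- t) * heat_envelope b c s d t * t `^ (sigma -
  1) = envelope_integrand p b c s d t.
  move=> t0; rewrite /heat_envelope /envelope_integrand.
  have -> : t `^ p = t `^ (- (1 / 2)) * t `^ (sigma - 1).
    by rewrite -powRD_gt0//; congr (_ `^ _); rewrite /p; field.
  by ring.
have kZ k c s d : 0 <= k ->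
   (\int[mu]_(t in `]0%R, +oo[) (k * envelope_integrand p b c s d t)%:E = k%:E
     * envelope_potential p b c s d)%E.
  move=> k0; under eq_integral do rewrite EFinM.
  rewrite ge0_integralZl_EFin//=.
  - by move=> t _; rewrite lee_fin envelope_integrand_ge0.
  - by apply/measurable_EFinP; apply: measurable_funTS;
      exact: measurable_envelope_integrand.
exists (A * C + (A * C^-1)^-1); split.
  by rewrite addr_gt0 ?invr_gt0 ?mulr_gt0 ?invr_gt0.
move=> x y x0 y0; set s := x + y; set d := `|x - y|.
have G0' c : (0 <= envelope_potential p b c s d)%E.
  by apply: integral_ge0 => t _; rewrite lee_fin envelope_integrand_ge0.
have W0 t : 0 < t -> 0 <= besselW alpha t x y.
  move=> t0; apply: le_trans (proj1 (HC t x y t0 x0 y0)).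
  by rewrite mulr_ge0 ?heat_envelope_ge0// invr_ge0 ltW.
have f0 t : `]0%R, +oo[%classic t ->
  0 <= expR (- t) * besselW alpha t x y * t `^ (sigma - 1).
  by rewrite /= in_itv/= andbT => t0;
    rewrite mulr_ge0 ?powR_ge0// mulr_ge0 ?expR_ge0 ?W0.
rewrite /besselH -/A; split.
- apply: (@le_trans _ _ ((A * C^-1)%:E * envelope_potential p b (3 / 8)%R s
    d)%E).
    rewrite lee_wpmul2r// lee_fin -[leRHS]invrK lef_pV2 ?posrE ?addr_gt0
      ?invr_gt0 ?mulr_gt0 ?invr_gt0//.
    by rewrite lerDr mulr_ge0// ltW.
  rewrite EFinM -muleA lee_wpmul2l ?lee_fin ?(ltW A0)//.
  rewrite -kZ ?invr_ge0 ?(ltW C0)//.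
  apply: ge0_le_integral_subset => // t.
    by move=> _; rewrite mulr_ge0 ?envelope_integrand_ge0// invr_ge0 ltW.
  rewrite /= in_itv/= andbT => t0; rewrite -kE//.
  have -> : C^-1 * (expR (- t) * heat_envelope b (3 / 8) s d t * t `^ (sigma -
    1)) =
    expR (- t) * (C^-1 * heat_envelope b (3 / 8) s d t) * t `^ (sigma - 1) by
      ring.
  rewrite ler_wpM2r ?powR_ge0// ler_wpM2l ?expR_ge0//.
  exact: proj1 (HC t x y t0 x0 y0).
- apply: (@le_trans _ _ ((A * C)%:E * envelope_potential p b (1 / 8)%R s d)%E);
    last first.
    by rewrite lee_wpmul2r// lee_fin lerDl invr_ge0; apply: mulr_ge0;
      rewrite ?invr_ge0 ltW.
  rewrite EFinM -muleA lee_wpmul2l ?lee_fin ?(ltW A0)//.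
  rewrite -kZ ?(ltW C0)//.
  apply: ge0_le_integral_subset => // t.
    by move=> _; rewrite mulr_ge0 ?envelope_integrand_ge0// ltW.
  rewrite /= in_itv/= andbT => t0; rewrite -kE//.
  have -> : C * (expR (- t) * heat_envelope b (1 / 8) s d t * t `^ (sigma - 1))
    =
    expR (- t) * (C * heat_envelope b (1 / 8) s d t) * t `^ (sigma - 1) by ring.
  rewrite ler_wpM2r ?powR_ge0// ler_wpM2l ?expR_ge0//.
  exact: proj2 (HC t x y t0 x0 y0).
Qed.

(** Let the scale of [envelope_potential_ge_block], or of
    [envelope_potential_ge_ln_diag] when p = -1, tend to 0. *)
Lemma envelope_potential_diag p b c s : p <= -1 -> 0 <= c -> 0 < s ->
  envelope_potential p b c s 0 = +oo%E.
Proof.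
move=> p1 c0 s0; apply/eqyP => A A0.
pose m := Num.min s 1.
have m0 : 0 < m by rewrite lt_min s0 ltr01.
have ms : m <= s by rewrite ge_min lexx.
have m1 : m <= 1 by rewrite ge_min lexx orbT.
have Y0 : 0 < (s ^+ 2) `^ (- b) by rewrite powR_gt0// exprn_gt0.
move: p1; rewrite le_eqVlt => /orP[/eqP ->|p1].
  have [k [k0 Hk]] := envelope_potential_ge_ln_diag b c c0.
  have kY : 0 < k * (s ^+ 2) `^ (- b) by rewrite mulr_gt0.
  set B := A / (k * (s ^+ 2) `^ (- b)).
  have B0 : 0 < B by rewrite divr_gt0.
  (* the scale at which k S ln (m / e) is exactly A *)
  pose e := m * expR (- B).
  have e0 : 0 < e by rewrite mulr_gt0 ?expR_gt0.
  have em : e <= m by rewrite ler_piMr ?(ltW m0)// expR_le1; lra.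
  apply: le_trans (Hk s 0 e m e0 em m1 ms (lexx _) (ltW e0)).
  have -> : m / e = expR B.
    by rewrite /e expRN; field; rewrite !gt_eqF ?expR_gt0.
  by rewrite expRK lee_fin mulrA /B mulrC divfK// gt_eqF.
have [k [k0 Hk]] := envelope_potential_ge_block p b c c0.
have kY : 0 < k * (s ^+ 2) `^ (- b) by rewrite mulr_gt0.
set B := A / (k * (s ^+ 2) `^ (- b)).
have B0 : 0 < B by rewrite divr_gt0.
have q0 : 2 * (p + 1) < 0 by lra.
pose e := Num.min m (B `^ (2 * (p + 1))^-1).
have e0 : 0 < e by rewrite lt_min m0 powR_gt0.
have em : e <= m by rewrite ge_min lexx.
have eB : e <= B `^ (2 * (p + 1))^-1 by rewrite ge_min lexx orbT.
apply: le_trans (Hk s 0 e e0 (le_trans em m1) (le_trans em ms) (lexx _) (ltW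
  e0)).
rewrite lee_fin mulrA mulrC -ler_pdivrMr//.
rewrite (powR_sqr e) ?(ltW e0)//.
apply: le_trans (powR_ge_base _ _ _ (ltW q0) e0 eB).
by rewrite -powRrM mulVf ?lt_eqF// powRr1 ?(ltW B0).
Qed.

(** The finite value, off the diagonal or for sigma > 1/2, of the factor that
    carries the singularity in [d]. *)
Definition near_factor sigma s d : R :=
  if sigma < 1 / 2 then d `^ (2 * sigma - 1)
  else if sigma == 1 / 2 then ln (2 * s / d) else s `^ (2 * sigma - 1).

Definition far_factor sigma d : R :=
  if sigma < 1 / 2 then d `^ (2 * sigma - 1)
  else if sigma == 1 / 2 then 1 + Num.max (ln (1 / d)) 0 else 1.

Lemma log_quotE c d : 0 < c -> 0 < d -> log_quot c d = (ln (c / d))%:E.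
Proof.
move=> c0 d0; rewrite /log_quot inver gt_eqF// -EFinM lne_EFin//.
exact: divr_gt0.
Qed.

Lemma log_quot0 c : 0 < c -> log_quot c 0 = +oo%E.
Proof. by move=> c0; rewrite /log_quot inver eqxx gt0_muley ?lte_fin. Qed.

Lemma near_factorE sigma s d : 0 < s -> 0 <= d -> (sigma <= 1 / 2 -> 0 < d) ->
  (if (sigma < 1 / 2)%R then powRy d (2 * sigma - 1)
   else if (sigma == 1 / 2)%R then log_quot (2 * s) d
   else (s `^ (2 * sigma - 1))%:E) = (near_factor sigma s d)%:E.
Proof.
move=> s0 d0; rewrite /near_factor /powRy;
  case: (ltgtP sigma (1 / 2)) => // h /(_ isT) d00.
  by rewrite gt_eqF.
by rewrite log_quotE// mulr_gt0.
Qed.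

Lemma far_factorE sigma d : 0 <= d -> (sigma <= 1 / 2 -> 0 < d) ->
  (if (sigma < 1 / 2)%R then powRy d (2 * sigma - 1)
   else if (sigma == 1 / 2)%R then 1 + log_plus_quot 1 d
   else 1)%E = (far_factor sigma d)%:E.
Proof.
move=> d0; rewrite /far_factor /powRy;
  case: (ltgtP sigma (1 / 2)) => // h /(_ isT) d00.
  by rewrite gt_eqF.
by rewrite /log_plus_quot log_quotE// -EFin_max.
Qed.

Lemma near_factor_diag sigma s : 0 < s -> sigma <= 1 / 2 ->
  (if (sigma < 1 / 2)%R then powRy 0 (2 * sigma - 1)
   else if (sigma == 1 / 2)%R then log_quot (2 * s) 0
   else (s `^ (2 * sigma - 1))%:E) = +oo%E.
Proof.
move=> s0; case: (ltgtP sigma (1 / 2)) => // sg _.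
  by rewrite /powRy eqxx/= ifT//; lra.
by rewrite log_quot0// mulr_gt0.
Qed.

Lemma far_factor_diag sigma : sigma <= 1 / 2 ->
  (if (sigma < 1 / 2)%R then powRy (0 : R) (2 * sigma - 1)
   else if (sigma == 1 / 2)%R then 1 + log_plus_quot 1 0
   else 1)%E = +oo%E.
Proof.
case: (ltgtP sigma (1 / 2)) => // sg _; first by rewrite /powRy eqxx/= ifT//;
  lra.
by rewrite /log_plus_quot log_quot0// max_l ?leey// addey.
Qed.

(** Bounds for three summands are bounds for their sum, at the price of a
    factor 3; [G] may be infinite, which excludes adding the inequalities. *)
Lemma ge_avg3 (k u v w : R) (G : \bar R) : 0 < k ->
  ((k * u)%:E <= G -> (k * v)%:E <= G -> (k * w)%:E <= G ->
  (k / 3 * (u + v + w))%:E <= G)%E.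
Proof.
move=> k0; case: G => [G| |].
- by rewrite !lee_fin; lra.
- by move=> _ _ _; rewrite leey.
- by rewrite leeNy_eq.
Qed.

Definition near_bound alpha sigma s d : R :=
  (alpha + 1 < sigma)%R%:R + (sigma == alpha + 1)%R%:R * ln (1 / s)
  + s `^ (- 2 * alpha - 1) * near_factor sigma s d.

(** Each summand of [near_bound] comes from its own range of times. *)
Lemma near_lower alpha sigma c : 0 <= c -> exists k, 0 < k /\
  forall s d, 0 < s -> s <= 1 -> 0 <= d -> d <= s ->
  (sigma <= 1 / 2 -> 0 < d) ->
  ((k * near_bound alpha sigma s d)%:E
     <= envelope_potential (sigma - 3 / 2)%R (alpha + 1 / 2)%R c s d)%E.
Proof.
move=> c0; set p := sigma - 3 / 2; set b := alpha + 1 / 2.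
have [k1 [k10 H1]] := envelope_potential_ge_cst p b c c0.
have [k2 [k20 H2]] := envelope_potential_ge_ln_origin b c c0.
have [k3 [k30 H3]] := envelope_potential_ge_block p b c c0.
have [k4 [k40 H4]] := envelope_potential_ge_ln_diag b c c0.
pose k := Num.min (Num.min k1 k2) (Num.min k3 k4 / 2).
have k0 : 0 < k by rewrite !lt_min k10 k20/= divr_gt0// lt_min k30.
have kk1 : k <= k1 by rewrite !ge_min lexx.
have kk2 : k <= k2 by rewrite !ge_min lexx orbT.
have kk34 : k <= Num.min k3 k4 / 2 by rewrite !ge_min lexx orbT.
have m3 : Num.min k3 k4 <= k3 by rewrite ge_min lexx.
have m4 : Num.min k3 k4 <= k4 by rewrite ge_min lexx orbT.
have kk3 : k <= k3 / 2 by lra.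
have kk4 : k <= k4 / 2 by lra.
exists (k / 3); split; first by rewrite divr_gt0.
move=> s d s0 s1 d0 ds dpos; rewrite /near_bound.
have G0 : (0 <= envelope_potential p b c s d)%E.
  by apply: integral_ge0 => t _; rewrite lee_fin envelope_integrand_ge0.
have le_G (u v : R) : u <= v -> (v%:E <= envelope_potential p b c s d)%E ->
  (u%:E <= envelope_potential p b c s d)%E.
  by move=> uv; apply: le_trans; rewrite lee_fin.
have l0 : 0 <= ln (1 / s) by rewrite ln_ge0// ler_pdivlMr// mul1r.
apply: ge_avg3 => //.
- case: ltP => _; last by rewrite mulr0.
  by apply: le_G (H1 s d s0 s1 d0 ds); rewrite mulr1.
- case: eqP => [sE|_]; last by rewrite mul0r mulr0.
  rewrite mulr1n (mul1r (ln _)).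
  have pE : p = b - 1 by rewrite /p /b sE; field.
  apply: (le_G _ (k2 * ln (1 / s))); first by rewrite ler_wpM2r.
  by rewrite pE; exact: H2.
have SE := weightE alpha s (ltW s0).
rewrite SE -/b /near_factor.
set S := (s ^+ 2) `^ (- b); have S0 : 0 <= S by exact: powR_ge0.
have powE e : 0 <= e -> (e ^+ 2) `^ (p + 1) = e `^ (2 * sigma - 1).
  exact: sqr_powE.
have kk3' : k <= k3 by lra.
case: (ltgtP sigma (1 / 2)) dpos => [sg /(_ isT) d00|sg _|sg /(_ isT) d00].
- apply: le_G (H3 s d d d00 (le_trans ds s1) ds d0 (lexx _)).
  by rewrite powE// ler_wpM2r// mulr_ge0 ?powR_ge0.
- apply: le_G (H3 s d s s0 s1 (lexx _) d0 ds).
  by rewrite powE ?(ltW s0)// ler_wpM2r// mulr_ge0 ?powR_ge0.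
- have p1 : p = - 1 by rewrite /p sg; field.
  have L0 : 0 <= ln (s / d) by rewrite ln_ge0// ler_pdivlMr// mul1r.
  have -> : ln (2 * s / d) = ln 2 + ln (s / d).
    by rewrite -mulrA lnM ?posrE ?divr_gt0.
  have := H3 s d s s0 s1 (lexx _) d0 ds.
  have := H4 s d d s d00 ds s1 (lexx _) d0 (lexx _).
  rewrite -/S p1 addNr powRr0 mulr1.
  have ln2 : ln 2 <= 1 :> R by have := @le_ln1Dx R 1 ltac:(lra).
  have ln20 : 0 <= ln 2 :> R by rewrite ln_ge0// ler1n.
  case: (envelope_potential (-1) b c s d) => [G| |]; rewrite ?leey ?leeNy_eq//.
  rewrite !lee_fin => h1 h2.
  have SL : 0 <= S * ln (s / d) by rewrite mulr_ge0.
  have e1 : k * (S * (ln 2 + ln (s / d))) = ln 2 * (k * S) + k * (S * ln (s /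
    d)) by ring.
  have e2 : ln 2 * (k * S) <= k * S by rewrite ler_piMl// mulr_ge0// ltW.
  have e3 : k * S <= k3 / 2 * S by rewrite ler_wpM2r.
  have e4 : k * (S * ln (s / d)) <= k4 / 2 * (S * ln (s / d)) by rewrite
    ler_wpM2r.
  by lra.
Qed.

(** For sigma <= alpha + 1, the times from s^2 to 1 contribute a power
    s^(2 sigma - 2 alpha - 2) besides the logarithm. Since d <= s, this power
    is at most a multiple of the third summand of [near_bound]. *)
Lemma near_upper alpha sigma c : 0 < c -> exists K, 0 < K /\
  forall s d, 0 < s -> s <= 1 -> 0 <= d -> d <= s ->
  (sigma <= 1 / 2 -> 0 < d) ->
  (envelope_potential (sigma - 3 / 2)%R (alpha + 1 / 2)%R c s d
     <= (K * near_bound alpha sigma s d)%:E)%E.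
Proof.
move=> c0; set p := sigma - 3 / 2; set b := alpha + 1 / 2.
have [K [K0 HK]] := envelope_potential_le_near p b c c0.
have ln20 : 0 < ln 2 :> R by rewrite ln_gt0// ltr1n.
pose C := 1 + (ln 2)^-1 : R.
have C1 : 1 <= C by rewrite lerDl invr_ge0 ltW.
exists (K * (2 * C)); split; first by rewrite mulr_gt0//; lra.
move=> s d s0 s1 d0 ds dpos.
have pd : p <= -1 -> 0 < d by move=> p1; apply: dpos; move: p1; rewrite /p; lra.
apply: (le_trans (HK s d s0 s1 d0 pd)).
rewrite lee_fin -mulrA ler_wpM2l ?(ltW K0)// /near_bound.
have l0 : 0 <= ln (1 / s) by rewrite ln_ge0// ler_pdivlMr// mul1r.
have SE := weightE alpha s (ltW s0).
have powE e : 0 <= e -> (e ^+ 2) `^ (p + 1) = e `^ (2 * sigma - 1).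
  exact: sqr_powE.
rewrite SE -/b; set S := (s ^+ 2) `^ (- b); have S0 : 0 <= S by exact: powR_ge0.
have [phile sle] : near_profile p s d <= C * near_factor sigma s d /\
    (s ^+ 2) `^ (p + 1) <= C * near_factor sigma s d.
  rewrite powE ?(ltW s0)// /near_profile /near_factor.
  have -> : (p < -1) = (sigma < 1 / 2) by apply/idP/idP; rewrite /p; lra.
  have -> : (p == -1) = (sigma == 1 / 2).
    by apply/eqP/eqP; rewrite /p => h; [lra|rewrite h; field].
  rewrite !powE ?(ltW s0)//.
  case: (ltgtP sigma (1 / 2)) dpos => [sg /(_ isT) d00|sg _|sg /(_ isT) d00].
  - have h : s `^ (2 * sigma - 1) <= d `^ (2 * sigma - 1) by apply:
      powR_ge_base; lra.
    have h0 : 0 <= d `^ (2 * sigma - 1) by exact: powR_ge0.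
    have : d `^ (2 * sigma - 1) <= C * d `^ (2 * sigma - 1) by rewrite ler_peMl.
    by split; lra.
  - have h0 : 0 <= s `^ (2 * sigma - 1) by exact: powR_ge0.
    have : s `^ (2 * sigma - 1) <= C * s `^ (2 * sigma - 1) by rewrite ler_peMl.
    by split; lra.
  - have L0 : 0 <= ln (s / d) by rewrite ln_ge0// ler_pdivlMr// mul1r.
    have -> : ln (2 * s / d) = ln 2 + ln (s / d).
      by rewrite -mulrA lnM ?posrE ?divr_gt0.
    rewrite max_l// (_ : 2 * sigma - 1 = 0); last by rewrite sg; field.
    have e : C * (ln 2 + ln (s / d)) = ln 2 + 1 + ln (s / d) + (ln 2)^-1 * ln
      (s / d).
      by rewrite /C; field; rewrite gt_eqF.
    have e0 : 0 <= (ln 2)^-1 * ln (s / d) by rewrite mulr_ge0// invr_ge0 ltW.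
    by rewrite powRr0 e; split; lra.
set F := near_factor sigma s d in phile sle *.
have hS : S * near_profile p s d <= C * (S * F) by rewrite mulrCA ler_wpM2l.
have hS2 : (s ^+ 2) `^ (p - b + 1) <= C * (S * F).
  have -> : p - b + 1 = - b + (p + 1) by ring.
  by rewrite powRD_gt0 ?exprn_gt0// mulrCA ler_wpM2l.
have F0 : 0 <= C * (S * F) by apply: le_trans hS2; exact: powR_ge0.
have psile : middle_profile (p - b) s <= (alpha + 1 < sigma)%R%:R + (sigma ==
  alpha + 1)%R%:R * ln (1 / s) + C * (S * F).
  rewrite /middle_profile.
  have -> : (-1 < p - b) = (alpha + 1 < sigma) by apply/idP/idP;
    rewrite /p /b; lra.
  have -> : (p - b == -1) = (sigma == alpha + 1).
    by apply/eqP/eqP; rewrite /p /b => h; [lra|rewrite h; field].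
  case: (ltgtP (alpha + 1) sigma) => h;
    rewrite /= ?mulr1n ?mulr0n ?(mul1r (ln _)) ?(mul0r (ln _)); [lra|lra|].
  move: hS2; rewrite (_ : p - b + 1 = 0) ?powRr0; first lra.
  by rewrite /p /b -h; field.
set U := (alpha + 1 < sigma)%R%:R + _ in psile *.
have U0 : 0 <= U by rewrite addr_ge0 ?mulr_ge0.
have : U <= C * U by rewrite ler_peMl.
have -> : 2 * C * (U + S * F) = 2 * (C * U) + 2 * (C * (S * F)) by ring.
by lra.
Qed.

Definition far_bound alpha sigma s d : R :=
  s `^ (- 2 * alpha - 1) * far_factor sigma d.

(** For d >= 1 the window at t = 1 + d suffices; for d < 1 the singularity in
    [d] comes from the small times. *)
Lemma far_lower alpha sigma c : 0 <= c -> exists k c1, [/\ 0 < k, 0 < c1 &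
  forall s d, 1 < s -> 0 <= d -> (sigma <= 1 / 2 -> 0 < d) ->
  ((k * far_bound alpha sigma s d * expR (- (c1 * d)))%:E
     <= envelope_potential (sigma - 3 / 2)%R (alpha + 1 / 2)%R c s d)%E].
Proof.
move=> c0; set p := sigma - 3 / 2; set b := alpha + 1 / 2.
have [k1 [k10 H1]] := envelope_potential_ge_far p b c c0.
have [k3 [k30 H3]] := envelope_potential_ge_block p b c c0.
have [k4 [k40 H4]] := envelope_potential_ge_ln_diag b c c0.
pose k := Num.min k1 (Num.min k3 k4) / 2.
have m1 : Num.min k1 (Num.min k3 k4) <= k1 by rewrite ge_min lexx.
have m3 : Num.min k1 (Num.min k3 k4) <= k3 by rewrite !ge_min lexx orbT.
have m4 : Num.min k1 (Num.min k3 k4) <= k4 by rewrite !ge_min lexx !orbT.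
have k0 : 0 < k by rewrite divr_gt0// !lt_min k10 k30.
have kk1 : k <= k1 / 2 by rewrite /k; lra.
have kk3 : k <= k3 / 2 by rewrite /k; lra.
have kk4 : k <= k4 / 2 by rewrite /k; lra.
exists k, (c + 2); split => //; first lra.
move=> s d s1 d0 dpos; rewrite /far_bound; have s0 : 0 < s by lra.
have le_G (u v : R) : u <= v -> (v%:E <= envelope_potential p b c s d)%E ->
  (u%:E <= envelope_potential p b c s d)%E.
  by move=> uv; apply: le_trans; rewrite lee_fin.
have SE := weightE alpha s (ltW s0).
rewrite SE -/b; set S := (s ^+ 2) `^ (- b); have S0 : 0 <= S by exact: powR_ge0.
set X := expR _; have X0 : 0 <= X by exact: expR_ge0.
have X1 : X <= 1 by rewrite expR_le1 oppr_le0 mulr_ge0//; lra.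
have SX0 : 0 <= S * X by rewrite mulr_ge0.
have h1 := H1 s d (ltW s1) d0.
rewrite -/S -/X in h1.
have kS : k * (S * X) <= k1 * (S * X) / 2.
  by have := ler_wpM2r SX0 kk1; lra.
have kSX0 : 0 <= k1 * (S * X) by rewrite mulr_ge0// ltW.
have powE e : 0 <= e -> (e ^+ 2) `^ (p + 1) = e `^ (2 * sigma - 1).
  exact: sqr_powE.
rewrite /far_factor.
case: (ltgtP sigma (1 / 2)) dpos => [sg /(_ isT) d00|sg _|sg /(_ isT) d00].
- have [d1|d1] := leP d 1.
    apply: le_G (H3 s d d d00 d1 (le_trans d1 (ltW s1)) d0 (lexx _)).
    rewrite powE// -/S; set D := d `^ _.
    have SD0 : 0 <= S * D by rewrite mulr_ge0 ?powR_ge0.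
    apply: (@le_trans _ _ (k * (S * D) * 1)).
      by rewrite ler_wpM2l// mulr_ge0// ltW.
    by rewrite mulr1 ler_wpM2r//; lra.
  apply: le_G h1; set D := d `^ _.
  have D1 : D <= 1.
    have := @powR_ge_base R (2 * sigma - 1) 1 d; rewrite powR1; apply => //;
      lra.
  have -> : k * (S * D) * X = D * (k * (S * X)) by ring.
  have : D * (k * (S * X)) <= k * (S * X) by rewrite ler_piMl// mulr_ge0// ltW.
  by lra.
- apply: le_G h1; rewrite mulr1 -mulrA; lra.
have p1 : p = - 1 by rewrite /p sg; field.
have -> : k * (S * (1 + Num.max (ln (1 / d)) 0)) * X = k * (S * X) + k * (S *
  X) * Num.max (ln (1 / d)) 0 by ring.
have [d1|d1] := leP d 1; last first.
  rewrite max_r; first by apply: le_G h1; rewrite mulr0 addr0; lra.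
  by apply: ln_le0; rewrite ler_pdivrMr// mul1r ltW.
have L0 : 0 <= ln (1 / d) by rewrite ln_ge0// ler_pdivlMr// mul1r.
rewrite max_l//.
have := H4 s d d 1 d00 d1 (lexx _) (ltW s1) d0 (lexx _).
move: h1; rewrite p1 -/S.
case: (envelope_potential (-1) b c s d) => [G| |]; rewrite ?leey ?leeNy_eq//.
rewrite !lee_fin => h1 h2.
have SL : 0 <= S * ln (1 / d) by rewrite mulr_ge0.
have e1 : k * (S * X) * ln (1 / d) <= k * (S * ln (1 / d)).
  have -> : k * (S * X) * ln (1 / d) = X * (k * (S * ln (1 / d))) by ring.
  by rewrite ler_piMl// mulr_ge0// ltW.
have e2 : k * (S * ln (1 / d)) <= k4 / 2 * (S * ln (1 / d)) by rewrite
  ler_wpM2r.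
by lra.
Qed.

(** Half of the exponential decay is given up in order to bound the constant
    contributed by the times beyond 1 by a multiple of d^(2 sigma - 1) when
    sigma < 1/2. *)
Lemma far_upper alpha sigma c : 0 < c -> exists K c2, [/\ 0 < K, 0 < c2 &
  forall s d, 1 < s -> 0 <= d -> (sigma <= 1 / 2 -> 0 < d) ->
  (envelope_potential (sigma - 3 / 2)%R (alpha + 1 / 2)%R c s d
    <= (K * far_bound alpha sigma s d * expR (- (c2 * d)))%:E)%E].
Proof.
move=> c0; set p := sigma - 3 / 2; set b := alpha + 1 / 2.
have [K [k [K0 k0 HK]]] := envelope_potential_le_far p b c c0.
have [C [C0 HC]] := powR_le_expR `|1 - 2 * sigma|
  (k / 2) (normr_ge0 _) ltac:(lra).
exists (K * (2 + C)), (k / 2); split; [by rewrite mulr_gt0//; lra|lra|].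
move=> s d s1 d0 dpos; have s0 : 0 < s by lra.
have pd : p <= -1 -> 0 < d by move=> p1; apply: dpos; move: p1; rewrite /p; lra.
apply: (le_trans (HK s d (ltW s1) d0 pd)).
have SE := weightE alpha s (ltW s0).
have powE e : 0 <= e -> (e ^+ 2) `^ (p + 1) = e `^ (2 * sigma - 1).
  exact: sqr_powE.
rewrite lee_fin /far_bound SE -/b; set S := (s ^+ 2) `^ (- b).
have S0 : 0 <= S by exact: powR_ge0.
set X := expR (- (k / 2 * d)); have X0 : 0 < X by exact: expR_gt0.
have -> : expR (- (k * d)) = X * X by rewrite -expRD; congr expR; field.
have X1 : X <= 1 by rewrite expR_le1 oppr_le0 mulr_ge0//; lra.
have -> : K * (S * (near_profile p 1 d + 1) * (X * X)) = K * (S * X *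
  ((near_profile p 1 d + 1) * X)) by ring.
have -> : K * (2 + C) * (S * far_factor sigma d) * X = K * (S * X * ((2 + C) *
  far_factor sigma d)) by ring.
rewrite ler_wpM2l ?(ltW K0)// ler_wpM2l ?mulr_ge0 ?(ltW X0)//.
rewrite /near_profile /far_factor.
have -> : (p < -1) = (sigma < 1 / 2) by apply/idP/idP; rewrite /p; lra.
have -> : (p == -1) = (sigma == 1 / 2).
  by apply/eqP/eqP; rewrite /p => h; [lra|rewrite h; field].
rewrite !powE//.
case: (ltgtP sigma (1 / 2)) dpos => [sg /(_ isT) d00|sg _|sg /(_ isT) d00].
- set D := d `^ _; have D0 : 0 < D by rewrite powR_gt0.
  have h : X <= C * D.
    have := HC d d00; rewrite ger0_norm; last lra.
    rewrite (_ : 1 - 2 * sigma = - (2 * sigma - 1)); last by ring.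
    rewrite powRN -/D -[leLHS]mul1r ler_pdivrMr// => h.
    by rewrite /X expRN -[leLHS]mul1r ler_pdivrMr ?expR_gt0// mulrAC.
  have : D * X <= D by rewrite ler_piMr// ltW.
  by rewrite mulrDl mul1r mulrDl; lra.
- by rewrite powR1; have := ltW C0; lra.
- set L := Num.max _ _; have L0 : 0 <= L by rewrite le_max lexx orbT.
  have : (1 + L + 1) * X <= (1 + L + 1) by rewrite ler_piMr//; lra.
  have := mulr_ge0 (ltW C0) L0; lra.
Qed.
(** A single constant absorbs those of the comparison with the envelopes and
    those of the bounds for the envelope potentials. *)
Lemma sandwich_constant (C k K : R) : 0 < C -> 0 < k -> 0 < K ->
  exists M, 0 < M /\ forall (G1 G2 H : \bar R) (u v : R), 0 <= u -> 0 <= v ->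
  ((C^-1)%:E * G1 <= H -> H <= C%:E * G2 -> (k * u)%:E <= G1 ->
    G2 <= (K * v)%:E ->
   (M^-1 * u)%:E <= H /\ H <= (M * v)%:E)%E.
Proof.
move=> C0 k0 K0.
have M1 : 0 < C * K by rewrite mulr_gt0.
have M2 : 0 < C^-1 * k by rewrite mulr_gt0 ?invr_gt0.
exists (C * K + (C^-1 * k)^-1); split; first by rewrite addr_gt0 ?invr_gt0.
move=> G1 G2 H u v u0 v0 H1 H2 h1 h2; split.
- apply: le_trans H1; apply: (@le_trans _ _ ((C^-1)%:E * (k * u)%:E)%E);
    last first.
    by rewrite lee_wpmul2l// lee_fin invr_ge0 ltW.
  rewrite -EFinM lee_fin mulrA ler_wpM2r// -[leRHS]invrK.
  by rewrite lef_pV2 ?posrE ?addr_gt0 ?invr_gt0// lerDr ltW.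
- apply: (le_trans H2); apply: (@le_trans _ _ (C%:E * (K * v)%:E)%E).
    by rewrite lee_wpmul2l// lee_fin ltW.
  by rewrite -EFinM lee_fin mulrA ler_wpM2r// lerDl invr_ge0 ltW.
Qed.
End Assembly.

Theorem theorem2p7 (R : realType) (alpha sigma : R)
    (halpha : -1 < alpha) (hsigma : 0 < sigma) :
  simeq_on (fun x y => x + y <= 1)
    (fun x y => besselH alpha sigma x y)
    (fun x y =>
       (((alpha + 1 < sigma)%R%:R)%:E
        + ((sigma == alpha + 1)%R%:R * ln (1 / (x + y)))%:E
        + ((x + y) `^ (- 2 * alpha - 1))%:E *
          (if (sigma < 1 / 2)%R then powRy `|x - y|%R (2 * sigma - 1)
           else if (sigma == 1 / 2)%R then log_quot (2 * (x + y)) `|x - y|%R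
           else ((x + y) `^ (2 * sigma - 1))%:E))%E)
  /\
  simeq_exp_on (fun x y => 1 < x + y)
    (fun x y => besselH alpha sigma x y)
    (fun x y =>
       (((x + y) `^ (- 2 * alpha - 1))%:E *
          (if (sigma < 1 / 2)%R then powRy `|x - y|%R (2 * sigma - 1)
           else if (sigma == 1 / 2)%R then 1 + log_plus_quot 1 `|x - y|%R
           else 1))%E)
    (fun x y => `|x - y|).
Proof.
have [C [C0 HC]] := besselH_envelope alpha sigma halpha hsigma.
have dist_le (x y : R) : 0 < x -> 0 < y -> `|x - y| <= x + y.
  by move=> x0 y0; rewrite ler_norml; lra.
have CV0 : 0 < C^-1 by rewrite invr_gt0.
have diag (x y : R) : 0 < x -> 0 < y -> sigma <= 1 / 2 -> `|x - y| = 0 ->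
    besselH alpha sigma x y = +oo%E.
  move=> x0 y0 s12 d0; apply/eqP; rewrite -leye_eq.
  apply: le_trans (proj1 (HC x y x0 y0)).
  by rewrite d0 envelope_potential_diag ?gt0_muley ?lte_fin//; lra.
split.
- have [k [k0 Hk]] := near_lower alpha sigma (3 / 8) ltac:(lra).
  have [K [K0 HK]] := near_upper alpha sigma (1 / 8) ltac:(lra).
  have [M [M0 HM]] := sandwich_constant C k K C0 k0 K0.
  exists M; split => // x y x0 y0 s1.
  have s0 : 0 < x + y by lra.
  have ds := dist_le x y x0 y0.
  have [H1 H2] := HC x y x0 y0.
  set s := x + y in s0 s1 ds H1 H2 *; set d := `|x - y| in ds H1 H2 *.
  have d0 : 0 <= d by exact: normr_ge0.
  have S0 : 0 < s `^ (- 2 * alpha - 1) by rewrite powR_gt0.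
  have [dpos|] := pselect (sigma <= 1 / 2 -> 0 < d); last first.
    move=> /not_implyP[s12 /negP]; rewrite -leNgt => d1.
    have d00 : d = 0 by lra.
    rewrite diag// d00 near_factor_diag// gt0_muley ?lte_fin// addey//.
    by rewrite !gt0_muley ?lte_fin ?invr_gt0.
  rewrite near_factorE// -EFinM -!EFinD -/(near_bound alpha sigma s d) -!EFinM.
  have {}HK := HK s d s0 s1 d0 ds dpos.
  have r0 : 0 <= near_bound alpha sigma s d.
    rewrite -(pmulr_rge0 _ K0) -lee_fin; apply: le_trans HK.
    by apply: integral_ge0 => t _; rewrite lee_fin envelope_integrand_ge0.
  exact: (HM _ _ _ _ _ r0 r0 H1 H2 (Hk s d s0 s1 d0 ds dpos) HK).
- have [k [c1 [k0 c10 Hk]]] := far_lower alpha sigma (3 / 8) ltac:(lra).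
  have [K [c2 [K0 c20 HK]]] := far_upper alpha sigma (1 / 8) ltac:(lra).
  have [M [M0 HM]] := sandwich_constant C k K C0 k0 K0.
  exists M, c1, c2; split => // x y x0 y0 s1.
  have s0 : 0 < x + y by lra.
  have [H1 H2] := HC x y x0 y0.
  set s := x + y in s0 s1 H1 H2 *; set d := `|x - y| in H1 H2 *.
  have d0 : 0 <= d by exact: normr_ge0.
  have S0 : 0 < s `^ (- 2 * alpha - 1) by rewrite powR_gt0.
  have [dpos|] := pselect (sigma <= 1 / 2 -> 0 < d); last first.
    move=> /not_implyP[s12 /negP]; rewrite -leNgt => d1.
    have d00 : d = 0 by lra.
    rewrite diag// d00 far_factor_diag// gt0_muley ?lte_fin//.
    by rewrite !gt0_muley ?lte_fin ?invr_gt0// !gt0_mulye ?lte_fin ?expR_gt0.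
  rewrite far_factorE// -[(_ * (far_factor _ _)%:E)%E]/((far_bound alpha sigma
    s d)%:E) -!EFinM.
  rewrite -(mulrA M^-1) -(mulrA M).
  have {}Hk := Hk s d s1 d0 dpos.
  have {}HK := HK s d s1 d0 dpos.
  rewrite -(mulrA k) in Hk; rewrite -(mulrA K) in HK.
  have X2 := expR_gt0 (- (c2 * d)).
  have r0 : 0 <= far_bound alpha sigma s d.
    rewrite -(pmulr_rge0 _ K0) -(pmulr_lge0 _ X2) -mulrA -lee_fin.
    apply: le_trans HK.
    by apply: integral_ge0 => t _; rewrite lee_fin envelope_integrand_ge0.
  have r1 : 0 <= far_bound alpha sigma s d * expR (- (c1 * d)).
    by rewrite mulr_ge0 ?expR_ge0.
  by apply: (HM _ _ _ _ _ r1 _ H1 H2 Hk HK); rewrite mulr_ge0 ?expR_ge0.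
Qed.
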